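(* Let $p\ge 1$ and $\gamma_1,\beta_1,\dots,\gamma_p,\beta_p\in\mathbb{R}$ be fixed, and let $\ell\ge1$ be an integer. For even $L$ let $|\psi_L\rangle=e^{-i\beta_pH_1}e^{-i\gamma_pH_2}\cdots e^{-i\beta_1H_1}e^{-i\gamma_1H_2}|0\cdots0\rangle\in(\mathbb{C}^2)^{\otimes L}$. Then in the thermodynamic limit the connected $XX$ correlation (which is independent of the site $j$) is $$\lim_{L\to\infty}\Big(\langle\psi_L|X_jX_{j+\ell}|\psi_L\rangle-\langle\psi_L|X_j|\psi_L\rangle^2\Big)=\left|\frac1\pi\int_{-\pi}^{\pi}\frac{g_{2p}(k)e^{-ik\ell}}{1+|g_{2p}(k)|^2}\,dk\right|^2-\left|\frac1\pi\int_{-\pi}^{\pi}\frac{|g_{2p}(k)|^2e^{-ik\ell}}{1+|g_{2p}(k)|^2}\,dk\right|^2 .$$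
   Context: $X_j,Y_j,Z_j$ are Pauli operators on $(\mathbb{C}^2)^{\otimes L}$, periodic boundary conditions ($Z_{L+1}=Z_1$). $H_1=-\sum_{j=1}^L Z_jZ_{j+1}$, $H_2=-\sum_{j=1}^L X_j$. $Z|0\rangle=|0\rangle$. For $k\in(-\pi,\pi)\setminus\{0\}$ define, with values in the Riemann sphere (right-hand sides read as Möbius transformations), $f_0(k)=0$, $$f_{2j+1}(k)=e^{-4i\gamma_{j+1}}\frac{1-i\tan(k/2)f_{2j}(k)}{f_{2j}(k)-i\tan(k/2)}\ (0\le j\le p-1),\qquad f_{2j}(k)=e^{-4i\beta_j}\frac{1+i\tan(k/2)f_{2j-1}(k)}{f_{2j-1}(k)+i\tan(k/2)}\ (1\le j\le p),$$ and $g_{2p}(k)=\dfrac{1-i\tan(k/2)f_{2p}(k)}{f_{2p}(k)-i\tan(k/2)}$. Conventions at $z=\infty$: $z/(1+|z|^2)=0$ and $|z|^2/(1+|z|^2)=1$. *)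

(* Defs.v *)
From HB Require Import structures.
From mathcomp Require Import all_boot all_order all_algebra.
From mathcomp Require Import complex.
From mathcomp Require Import all_classical all_reals all_analysis.

Set Implicit Arguments.
Unset Strict Implicit.
Unset Printing Implicit Defensive.

Import Order.TTheory GRing.Theory Num.Theory.
Import numFieldNormedType.Exports.

Local Open Scope classical_set_scope.
Local Open Scope ring_scope.
Local Open Scope complex_scope.
Local Open Scope sesquilinear_scope.

(* The exponential series, summed entry by entry; over the complex numbers it
   converges for every A. *)
Definition expmx (K : numFieldType) (n : nat) (A : 'M[K]_n) : 'M[K]_n :=
  \matrix_(i, j)
    lim ((\sum_(0 <= k < N) (k`!%:R)^-1 *: A ^+ k) i j @[N --> \oo]).

Section SpinChain.
Variables (R : realType) (L : nat).

(* Computational basis of (C^2)^{\otimes L}: the value 0 at a site stands for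
   |0>, the value 1 for |1>. *)
Definition config : finType := {ffun 'I_L -> 'I_2}.

Definition operator := 'M[R[i]]_#|config|.
Definition state := 'cV[R[i]]_#|config|.

Definition pauliX : 'M[R[i]]_2 := \matrix_(a, b) (a != b)%:R.
Definition pauliZ : 'M[R[i]]_2 := \matrix_(a, b) ((-1) ^+ a *+ (a == b)).

(* 1 \otimes ... \otimes P \otimes ... \otimes 1 with P in position j. *)
Definition at_site (P : 'M[R[i]]_2) (j : 'I_L) : operator :=
  \matrix_(s, t)
    let u : config := enum_val s in
    let v : config := enum_val t in
    P (u j) (v j) * (\prod_(i < L | i != j) (u i == v i)%:R).

Definition X_ (j : 'I_L) : operator := at_site pauliX j.
Definition Z_ (j : 'I_L) : operator := at_site pauliZ j.

(* ordS is the cyclic successor on 'I_L, i.e. periodic boundary conditions. *)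
Definition H1 : operator := - \sum_(j < L) Z_ j *m Z_ (ordS j).
Definition H2 : operator := - \sum_(j < L) X_ j.

Definition ket0 : state := delta_mx (enum_rank ([ffun=> ord0] : config)) 0.

(* e^{-i beta_p H_1} e^{-i gamma_p H_2} ... e^{-i beta_1 H_1} e^{-i gamma_1 H_2}
   |0...0>; the parameters are numbered from 1, so that only the values at
   1, ..., p matter. *)
Fixpoint psi (gamma beta : nat -> R) (p : nat) : state :=
  if p is q.+1 then
    expmx (- 'i%C * (beta q.+1)%:C *: H1) *m
      (expmx (- 'i%C * (gamma q.+1)%:C *: H2) *m psi gamma beta q)
  else ket0.

Definition expval (v : state) (A : operator) : R[i] :=
  ((v ^t*) *m A *m v) 0 0.

Definition shift_site (l : nat) (j : 'I_L) : 'I_L := iter l (@ordS L) j.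

Definition connectedXX (gamma beta : nat -> R) (p l : nat) (j : 'I_L) : R[i] :=
  expval (psi gamma beta p) (X_ j *m X_ (shift_site l j))
  - expval (psi gamma beta p) (X_ j) ^+ 2.

End SpinChain.

Section Riemann.
Variable R : realType.

(* None is the point at infinity. *)
Definition sphere := option R[i].

(* z |-> (a z + b) / (c z + d), meant for a d - b c <> 0. *)
Definition mobius (a b c d : R[i]) (z : sphere) : sphere :=
  match z with
  | Some w => if c * w + d == 0 then None else Some ((a * w + b) / (c * w + d))
  | None => if c == 0 then None else Some (a / c)
  end.

Definition expi (x : R) : R[i] := cos x +i* sin x.

Definition itan (k : R) : R[i] := 'i%C * (tan (k / 2))%:C.

(* f_m(k): the step from m to m.+1 uses gamma_{j+1} when m = 2j, and
   beta_{j+1} when m = 2j+1. *)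
Fixpoint f_ (gamma beta : nat -> R) (m : nat) (k : R) : sphere :=
  if m is n.+1 then
    if odd n then
      let e := expi (- (4 * beta n./2.+1)) in
      mobius (e * itan k) e 1 (itan k) (f_ gamma beta n k)
    else
      let e := expi (- (4 * gamma n./2.+1)) in
      mobius (- (e * itan k)) e 1 (- itan k) (f_ gamma beta n k)
  else Some 0.

Definition g_ (gamma beta : nat -> R) (p : nat) (k : R) : sphere :=
  mobius (- itan k) 1 1 (- itan k) (f_ gamma beta p.*2 k).

(* z / (1 + |z|^2) *)
Definition ratio1 (z : sphere) : R[i] :=
  if z is Some w then w / (1 + `|w| ^+ 2) else 0.

(* |z|^2 / (1 + |z|^2) *)
Definition ratio2 (z : sphere) : R[i] :=
  if z is Some w then `|w| ^+ 2 / (1 + `|w| ^+ 2) else 1.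

(* Lebesgue integral over (-pi, pi) minus 0, the domain of f_ and g_; real and
   imaginary parts are integrated separately. *)
Definition integral_pi (h : R -> R[i]) : R[i] :=
  (\int[lebesgue_measure]_(k in `]-pi, pi[ `\ 0) complex.Re (h k)) +i*
  (\int[lebesgue_measure]_(k in `]-pi, pi[ `\ 0) complex.Im (h k)).

End Riemann.

(* Main.v *)
Require Import Defs.
From mathcomp Require Import all_boot all_order all_algebra.
From mathcomp Require Import complex.
From mathcomp Require Import all_classical all_reals all_analysis.
From mathcomp Require Import measurable_realfun.
From mathcomp Require Import ring lra zify.
Import Order.TTheory GRing.Theory Num.Theory.
Import numFieldNormedType.Exports.
Set Implicit Arguments.
Unset Strict Implicit.
Unset Printing Implicit Defensive.
Local Open Scope classical_set_scope.
Local Open Scope ring_scope.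
Local Open Scope complex_scope.

(** Majorana operators c_n turn the chain into free fermions: c_0 = Z_0 and
    c_{n+1} = -i c_n P_n, where P_{2j} = X_j and P_{2j+1} = Z_j Z_{j+1}.  Each
    layer of the circuit rotates neighbouring c_n into each other, and the bond
    Z_{L-1} Z_0 that closes the ring anticommutes with every bulk c_n, so it drops
    out of even products of them.  For |0...0> the four-point functions of the c_n
    satisfy Wick's formula and <c_n c_m> is the L^2 inner product over (-pi, pi) of
    the modes phi_{2j}(k) = e^{ikj}, phi_{2j+1}(k) = -i e^{ik(j+1)}.  Both facts
    survive a layer if the modes are rotated in the same way, away from the cut and
    up to the light cone.  Hence the connected correlation at a bulk site is exactly
    independent of L once L is large; translation invariance moves any site into the
    bulk.  Finally the Moebius recursion for f_m is the evolution of the two-component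
    mode in homogeneous coordinates. *)

(** The c_n are Jordan-Wigner operators with strings of X. Making the closed chain translation
    invariant in the fermions would require a definite parity of the product of all X_j, which
    |0...0> does not have; this is why the cut at the closing bond is kept out of reach by a light
    cone. The initial modes encode that i c_{2j+1} c_{2j+2} = Z_j Z_{j+1} fixes |0...0>. At each k a
    layer rotates a two-component mode. The X rotation has eigenvectors independent of k, those of
    the ZZ rotation depend on e^{ik}. In the eigenbasis of its own layer a rotation multiplies the
    two coordinates by e^{-2i angle} and e^{2i angle}, whence the phase e^{-4i angle} of their
    ratio; passing between the two eigenbases is the Moebius map with i tan(k/2) = (1 - e^{-ik}) /
    (1 + e^{-ik}). The map g is one more such change of basis. Wick's formula leaves two products of
    two-point functions. They become a difference of squared moduli because the two-point function
    of distinct c_n is purely imaginary and, for l >= 1, the two diagonal ones add up to 0, the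
    modes having constant norm. *)

Local Notation adj A := (map_mx Num.conj (trmx A)).

(** * Exponentials of commuting involutions *)

Section GenExp.
Variable K : numFieldType.

Lemma cvg_series_sum (I : Type) (r : seq I) (f : I -> nat -> K) (a : I -> K) :
  (forall i, (f i : nat -> K) @ \oo --> (a i : K)) ->
  (fun N => \sum_(i <- r) f i N : K) @ \oo --> (\sum_(i <- r) a i : K).
Proof.
move=> fa; elim: r => [|i r IH].
  rewrite (_ : (fun N => _) = fun=> 0) ?big_nil; first exact: cvg_cst.
  by apply/funext => N; rewrite big_nil.
rewrite (_ : (fun N => _) = fun N => f i N + \sum_(j <- r) f j N).
  by rewrite big_cons; apply: cvgD => //; exact: fa.
by apply/funext => N; rewrite big_cons.
Qed.

Variable n : nat.
Implicit Types (A B E : 'M[K]_n).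

(** [expmx] is defined by [lim], which by itself says nothing about convergence; this predicate
    keeps the convergence. *)
Definition is_exp A E := forall i j,
  (fun N => (\sum_(0 <= k < N) (k`!%:R)^-1 *: A ^+ k) i j : K) @ \oo
    --> (E i j : K).

Lemma is_exp_expmx A E : is_exp A E -> expmx A = E.
Proof.
by move=> AE; apply/matrixP => i j; rewrite mxE; apply: cvg_lim => //; exact: AE.
Qed.

(** The relation passes to powers, hence to partial sums, hence to the limit. It is used with B a
    Majorana operator and A' a layer in which some bonds have changed sign. *)
Lemma is_exp_intertwine A A' B E E' : is_exp A E -> is_exp A' E' ->
  B *m A = A' *m B -> B *m E = E' *m B.
Proof.
move=> AE AE' BA.
have BAk k : B *m A ^+ k = A' ^+ k *m B.
  elim: k => [|k IH]; first by rewrite !expr0 mulmx1 mul1mx.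
  by rewrite exprSr -mulmxE mulmxA IH -mulmxA BA mulmxA mulmxE -exprSr.
have BS N : B *m (\sum_(0 <= k < N) (k`!%:R)^-1 *: A ^+ k) =
            (\sum_(0 <= k < N) (k`!%:R)^-1 *: A' ^+ k) *m B.
  rewrite mulmx_sumr mulmx_suml; apply: eq_bigr => k _.
  by rewrite -scalemxAr -scalemxAl BAk.
apply/matrixP => i j.
have h1 : (fun N => (B *m (\sum_(0 <= k < N) (k`!%:R)^-1 *: A ^+ k)) i j : K)
    @ \oo --> ((B *m E) i j : K).
  rewrite mxE (_ : (fun N => _) = fun N => \sum_l B i l *
    (\sum_(0 <= k < N) (k`!%:R)^-1 *: A ^+ k) l j).
    by apply: cvg_series_sum => l; apply: cvgMl_tmp; exact: AE.
  by apply/funext => N; rewrite mxE.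
have h2 : (fun N => (B *m (\sum_(0 <= k < N) (k`!%:R)^-1 *: A ^+ k)) i j : K)
    @ \oo --> ((E' *m B) i j : K).
  rewrite mxE (_ : (fun N => _) = fun N => \sum_l
    (\sum_(0 <= k < N) (k`!%:R)^-1 *: A' ^+ k) i l * B l j).
    by apply: cvg_series_sum => l; apply: cvgMr_tmp; exact: AE'.
  by apply/funext => N; rewrite BS mxE.
exact: (cvg_unique _ h1 h2).
Qed.

End GenExp.

(* phI * phre t stands for i t, and phe t for its exponential. *)
Record phases (K : numClosedFieldType) (T : zmodType) := Phases {
  phI : K;
  phre : T -> K;
  phe : T -> K;
  phI_sqr : phI * phI = -1;
  phI_conj : Num.conj phI = - phI;
  phreD : forall s t, phre (s + t) = phre s + phre t;
  pheD : forall s t, phe (s + t) = phe s * phe t;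
  phe0 : phe 0 = 1;
  phe_conj : forall t, Num.conj (phe t) = phe (- t);
  phe_cvg : forall t, (fun N => \sum_(0 <= k < N)
     (k`!%:R)^-1 * (phI * phre t) ^+ k : K) @ \oo --> (phe t : K) }.

Section PhaseExp.
Variables (K : numClosedFieldType) (T : zmodType) (ph : phases K T).
Local Notation "''I'" := (phI ph).
Local Notation re := (phre ph).
Local Notation e := (phe ph).

Lemma phre0 : re 0 = 0.
Proof. by apply: (addrI (re 0)); rewrite -phreD !addr0. Qed.

Lemma phreN t : re (- t) = - re t.
Proof. by apply: (addrI (re t)); rewrite -phreD !subrr phre0. Qed.

Lemma pheNK t : e t * e (- t) = 1.
Proof. by rewrite -pheD subrr phe0. Qed.

Definition phcos t := (e t + e (- t)) / 2.
Definition phsin t := (e t - e (- t)) / (2 * 'I).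

Lemma phI_neq0 : 'I != 0.
Proof.
apply/eqP => i0; have := phI_sqr ph; rewrite i0 mul0r => /eqP.
by rewrite eq_sym oppr_eq0 oner_eq0.
Qed.

Variable n : nat.
Implicit Types (A B E P Q : 'M[K]_n) (s : seq (T * 'M[K]_n)).

(* A complete system of (not necessarily orthogonal) eigenprojections, with
   purely imaginary eigenvalues. *)
Definition resolves A s :=
  \sum_(x <- s) x.2 = 1%:M /\
  forall x, x \in s -> A *m x.2 = ('I * re x.1) *: x.2.

Definition resolvable A := exists s, resolves A s.

Definition cis s : 'M[K]_n := \sum_(x <- s) e x.1 *: x.2.

(** For an involution P this is the exponential of i t P. *)
Definition gate t P : 'M[K]_n := phcos t *: 1%:M + ('I * phsin t) *: P.

(** Powers of A act as scalars on each summand of the resolution, so the matrix series reduces to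
    the scalar series of [phe_cvg]. *)
Lemma resolves_exp A s : resolves A s -> is_exp A (cis s).
Proof.
move=> [s1 As] i j.
have Ak k : A ^+ k = \sum_(x <- s) ('I * re x.1) ^+ k *: x.2.
  elim: k => [|k IH].
    by rewrite expr0 -[LHS]s1; apply: eq_bigr => x _; rewrite expr0 scale1r.
  rewrite exprS IH -mulmxE mulmx_sumr !big_seq; apply: eq_bigr => x xs.
  by rewrite -scalemxAr As// scalerA -exprSr.
have -> : (fun N => (\sum_(0 <= k < N) (k`!%:R)^-1 *: A ^+ k) i j) =
   (fun N => \sum_(x <- s)
     (\sum_(0 <= k < N) (k`!%:R)^-1 * ('I * re x.1) ^+ k) * x.2 i j).
  apply/funext => N; rewrite summxE.
  under [RHS]eq_bigr do rewrite mulr_suml.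
  rewrite [RHS]exchange_big /=; apply: eq_bigr => k _.
  rewrite mxE Ak summxE mulr_sumr; apply: eq_bigr => x _.
  by rewrite mxE mulrA.
rewrite /cis summxE (eq_bigr (fun x : T * 'M[K]_n => e x.1 * x.2 i j)); last first.
  by move=> x _; rewrite mxE.
apply: cvg_series_sum => x; apply: cvgMr_tmp; exact: phe_cvg.
Qed.

Lemma resolves0 : resolves 0 [:: (0, 1%:M)].
Proof.
split; first by rewrite big_seq1.
by move=> x; rewrite inE => /eqP ->; rewrite mul0mx phre0 mulr0 scale0r.
Qed.

(** The projections (1 + P)/2 and (1 - P)/2 commute with A; they split each eigenprojection in two
    and shift its eigenvalue by i t and - i t. *)
Lemma resolvable_addP A P t s : resolves A s -> P *m P = 1%:M ->
  A *m P = P *m A ->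
  exists2 s', resolves (A + ('I * re t) *: P) s' &
    cis s' = gate t P *m cis s.
Proof.
move=> [s1 As] PP AP.
pose Pp : 'M[K]_n := 2^-1 *: (1%:M + P); pose Pm : 'M[K]_n := 2^-1 *: (1%:M - P).
have PPp : P *m Pp = Pp.
  by rewrite /Pp -scalemxAr mulmxDr mulmx1 PP addrC.
have PPm : P *m Pm = - Pm.
  by rewrite /Pm -scalemxAr mulmxBr mulmx1 PP -opprB scalerN.
have APp : A *m Pp = Pp *m A.
  by rewrite /Pp -scalemxAr -scalemxAl mulmxDr mulmxDl mulmx1 mul1mx AP.
have APm : A *m Pm = Pm *m A.
  by rewrite /Pm -scalemxAr -scalemxAl mulmxBr mulmxBl mulmx1 mul1mx AP.
have n2 : (2 : K) != 0 by rewrite pnatr_eq0.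
have Ppm : Pp + Pm = 1%:M.
  rewrite /Pp /Pm -scalerDr addrACA subrr addr0 -[X in X + X]scale1r -scalerDl.
  by rewrite scalerA -(natrD _ 1 1) mulVf ?scale1r.
have gE : gate t P = e t *: Pp + e (- t) *: Pm.
  apply/matrixP => i j; rewrite !mxE /phcos /phsin.
  by field; rewrite phI_neq0.
clearbody Pp Pm.
exists ([seq (x.1 + t, Pp *m x.2) | x <- s] ++ [seq (x.1 - t, Pm *m x.2) | x <- s]).
  split.
    by rewrite big_cat !big_map /= -!mulmx_sumr s1 !mulmx1.
  move=> x; rewrite mem_cat => /orP[] /mapP[y ys ->] /=.
    rewrite mulmxDl mulmxA APp -mulmxA As// -scalemxAr -scalemxAl mulmxA PPp.
    by rewrite -scalerDl -mulrDr -phreD.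
  rewrite mulmxDl mulmxA APm -mulmxA As// -scalemxAr -scalemxAl mulmxA PPm.
  by rewrite mulNmx scalerN -scaleNr -scalerDl -mulrN -mulrDr -phreN -phreD.
rewrite /cis big_cat !big_map /= gE mulmxDl -!scalemxAl !mulmx_sumr !scaler_sumr.
by congr (_ + _); apply: eq_bigr => x _; rewrite -scalemxAr scalerA pheD mulrC.
Qed.

Lemma resolvable_exp A : resolvable A -> is_exp A (expmx A).
Proof. by case=> s /resolves_exp AE; rewrite (is_exp_expmx AE). Qed.

Lemma resolvable0 : resolvable 0.
Proof. by exists [:: (0, 1%:M)]; exact: resolves0. Qed.

Lemma expmx0 : expmx (0 : 'M[K]_n) = 1%:M.
Proof.
by rewrite (is_exp_expmx (resolves_exp resolves0)) /cis big_seq1 phe0 scale1r.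
Qed.

Lemma resolvable_add A P t : resolvable A -> P *m P = 1%:M ->
  A *m P = P *m A -> resolvable (A + ('I * re t) *: P).
Proof.
by move=> [s As] PP AP; have [s' As' _] := resolvable_addP t As PP AP; exists s'.
Qed.

Lemma expmx_add A P t : resolvable A -> P *m P = 1%:M ->
  A *m P = P *m A ->
  expmx (A + ('I * re t) *: P) = gate t P *m expmx A.
Proof.
move=> [s As] PP AP; have [s' As' e] := resolvable_addP t As PP AP.
by rewrite (is_exp_expmx (resolves_exp As')) e (is_exp_expmx (resolves_exp As)).
Qed.

Lemma expmx_intertwine A A' B : resolvable A -> resolvable A' ->
  B *m A = A' *m B -> B *m expmx A = expmx A' *m B.
Proof. by move=> /resolvable_exp h /resolvable_exp h'; exact: is_exp_intertwine. Qed.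

Lemma gate_comm t P B : B *m P = P *m B -> B *m gate t P = gate t P *m B.
Proof.
by move=> BP; rewrite /gate mulmxDr mulmxDl -!scalemxAr -!scalemxAl mulmx1 mul1mx BP.
Qed.

Lemma phcosN t : phcos (- t) = phcos t.
Proof. by rewrite /phcos opprK addrC. Qed.

Lemma phsinN t : phsin (- t) = - phsin t.
Proof. by rewrite /phsin opprK -mulNr opprB. Qed.

Lemma gate_anticomm t P B : B *m P = - (P *m B) ->
  B *m gate t P = gate (- t) P *m B.
Proof.
move=> BP; rewrite /gate mulmxDr mulmxDl -!scalemxAr -!scalemxAl mulmx1 mul1mx BP.
by rewrite phcosN phsinN mulrN scalerN scaleNr.
Qed.

Lemma phcos2Dsin2 t : phcos t * phcos t + phsin t * phsin t = 1.
Proof.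
rewrite -(pheNK t) /phcos /phsin.
have i2 := phI_sqr ph.
(* To [ring] and [field] the imaginary unit is an indeterminate, so its square is isolated and
   rewritten by hand; the same device recurs below. *)
have -> : (e t - e (- t)) / (2 * 'I) * ((e t - e (- t)) / (2 * 'I)) =
  (e t - e (- t)) * (e t - e (- t)) / (4 * ('I * 'I)).
  by field; rewrite phI_neq0.
by rewrite i2; field.
Qed.

Lemma gateNK t P : P *m P = 1%:M -> gate (- t) P *m gate t P = 1%:M.
Proof.
move=> PP; rewrite /gate phcosN phsinN mulrN scaleNr mulmxBl !mulmxDr.
rewrite -!scalemxAr -!scalemxAl PP !mulmx1 !mul1mx.
apply/matrixP => i j; rewrite !mxE.
transitivity ((phcos t * phcos t - ('I * 'I) * (phsin t * phsin t))
   * (i == j)%:R : K); first by ring.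
by rewrite phI_sqr mulN1r opprK phcos2Dsin2 mul1r.
Qed.

Lemma phcos_conj t : Num.conj (phcos t) = phcos t.
Proof.
by rewrite /phcos rmorphM fmorphV rmorphD /= !phe_conj opprK conjC_nat addrC.
Qed.

Lemma phsin_conj t : Num.conj (phsin t) = phsin t.
Proof.
rewrite /phsin rmorphM fmorphV rmorphM rmorphB /= !phe_conj opprK conjC_nat phI_conj.
by rewrite mulrN invrN mulrN -mulNr opprB.
Qed.

Lemma adj_gate t P : adj P = P -> adj (gate t P) = gate (- t) P.
Proof.
move=> aP; apply/matrixP => i j.
have := congr1 (fun M : 'M[K]_n => M i j) aP; rewrite !mxE => aPij.
rewrite phcosN phsinN.
move: (phcos t) (phsin t) (phcos_conj t) (phsin_conj t) => c s hc hs.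
rewrite rmorphD !rmorphM /= aPij conjC_nat eq_sym hc hs phI_conj.
by rewrite mulrN mulNr.
Qed.

(** The exponential is a product of commuting gates, one for each involution, and the product with
    its adjoint telescopes by [gateNK]. *)
Lemma sum_involutions I (r : seq I) (P : I -> 'M[K]_n) t :
  (forall i, P i *m P i = 1%:M) -> (forall i j, P i *m P j = P j *m P i) ->
  (forall i, adj (P i) = P i) ->
  let A := ('I * re t) *: \sum_(i <- r) P i in
  resolvable A /\ adj (expmx A) *m expmx A = 1%:M.
Proof.
move=> PP Pc aP; elim: r => [|i r [IH1 IH2]].
  rewrite /= big_nil scaler0 expmx0; split; first exact: resolvable0.
  by rewrite trmx1 map_mx1 mulmx1.
rewrite /= big_cons scalerDr addrC.
have cP : (('I * re t) *: \sum_(j <- r) P j) *m P i =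
          P i *m (('I * re t) *: \sum_(j <- r) P j).
  rewrite -scalemxAl -scalemxAr mulmx_suml mulmx_sumr; congr (_ *: _).
  by apply: eq_bigr => j _.
split; first exact: resolvable_add.
rewrite expmx_add// trmx_mul map_mxM adj_gate// mulmxA -(mulmxA (adj _)).
by rewrite gateNK// mulmx1.
Qed.

End PhaseExp.

(** * The exponential series on the imaginary axis *)

Section Exp.
Variable R : realType.
Local Notation C := R[i].

Lemma sqrt_add_sqr_le (x y : R) : Num.sqrt (x ^+ 2 + y ^+ 2) <= `|x| + `|y|.
Proof.
have h : x ^+ 2 + y ^+ 2 <= (`|x| + `|y|) ^+ 2.
  by rewrite sqrrD !real_normK ?num_real// addrAC lerDl mulrn_wge0// mulr_ge0.
by apply: (le_trans (ler_wsqrtr h)); rewrite sqrtr_sqr ger0_norm// addr_ge0.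
Qed.

Lemma cvg_complex (u v : nat -> R) (a b : R) :
  u @ \oo --> a -> v @ \oo --> b ->
  (fun n => u n +i* v n : C^o) @ \oo --> (a +i* b : C^o).
Proof.
move=> /cvgrPdist_lt ua /cvgrPdist_lt vb; apply/cvgrPdist_lt => e.
(* A positive element of [R[i]] has zero imaginary part, so the tolerance is a real number. *)
rewrite ltcE /= => /andP[/eqP e0 e1].
have e2 : 0 < complex.Re e / 2 by lra.
near=> n.
have h1 : `|a - u n| < complex.Re e / 2 by near: n; apply: ua.
have h2 : `|b - v n| < complex.Re e / 2 by near: n; apply: vb.
rewrite normc_def ltcE /= e0 eqxx /=.
have h3 : `|a - u n| + `|b - v n| < complex.Re e by lra.
exact: le_lt_trans (sqrt_add_sqr_le _ _) h3.
Unshelve. all: by end_near.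
Qed.

Lemma expiD (x y : R) : expi (x + y) = expi x * expi y.
Proof. by rewrite /expi cosD sinD; simpc; congr (_ +i* _); ring. Qed.

Lemma expi0 : expi (0 : R) = 1.
Proof. by rewrite /expi cos0 sin0. Qed.

Lemma conj_expi (x : R) : (expi x)^* = expi (- x).
Proof. by rewrite /expi cosN sinN. Qed.

Lemma expiNK (x : R) : expi x * expi (- x) = 1.
Proof. by rewrite -expiD subrr expi0. Qed.

Lemma expiE (x : R) : expi x = (cos x)%:C + 'i%C * (sin x)%:C.
Proof. by rewrite /expi; simpc. Qed.

(** The closed form has the shape of [cos_coeffE] and [sin_coeffE], so that the exponential series
    splits term by term into the cosine and sine series. *)
Lemma iX (n : nat) : 'i%C ^+ n = ((~~ odd n)%:R * (-1) ^+ n./2) +i*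
   ((odd n)%:R * (-1) ^+ n.-1./2) :> C.
Proof.
elim: n => [|n IH]; first by rewrite expr0 /= mul1r mul0r.
rewrite exprS IH; simpc => /=; congr (_ +i* _).
  case: n {IH} => [|n] /=; first by rewrite !mul0r oppr0.
  case: (odd n) => /=; rewrite ?mul0r ?oppr0 ?mul1r//.
  by rewrite exprS mulN1r.
Qed.

Lemma cvg_expi (x : R) :
  (fun N => \sum_(0 <= k < N) (k`!%:R)^-1 * ('i%C * x%:C) ^+ k : C^o) @ \oo
    --> (expi x : C^o).
Proof.
have hc : series (cos_coeff x) @ \oo --> cos x.
  by rewrite cos.unlock; exact: is_cvg_series_cos_coeff.
have hs : series (sin_coeff x) @ \oo --> sin x.
  by rewrite sin.unlock; exact: is_cvg_series_sin_coeff.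
have := cvg_complex hc hs.
apply: cvg_trans; apply: near_eq_cvg; near=> N.
elim: {+}N => [|n IH]; first by rewrite /series /= !big_geq.
rewrite big_nat_recr//= -IH /series /= !big_nat_recr//= exprMn iX.
rewrite cos_coeffE sin_coeffE -rmorphXn /=.
have -> : (n`!%:R)^-1 = ((n`!%:R)^-1 : R)%:C :> C.
  by rewrite fmorphV rmorph_nat.
simpc; congr (_ +i* _); ring.
Unshelve. all: by end_near.
Qed.

End Exp.

(** * Majorana operators *)

Section SignedCommutation.
Variables (K : numClosedFieldType) (N : nat).
Implicit Types A B : 'M[K]_N.

(** The sign is a boolean so that the sign of a product is the exclusive or of the signs. *)
Definition scomm (b : bool) A B := A *m B = (-1) ^+ b *: (B *m A).

Lemma scommM b b' A A' B : scomm b A B -> scomm b' A' B ->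
  scomm (b (+) b') (A *m A') B.
Proof.
rewrite /scomm => AB A'B; rewrite -mulmxA A'B -scalemxAr (mulmxA A) AB.
by rewrite -scalemxAl scalerA -(mulmxA B) signr_addb mulrC.
Qed.

Lemma scommZ b a A B : scomm b A B -> scomm b (a *: A) B.
Proof.
by rewrite /scomm => AB; rewrite -scalemxAl AB -scalemxAr !scalerA mulrC.
Qed.

Lemma scommC b A B : scomm b A B -> scomm b B A.
Proof. by rewrite /scomm => ->; rewrite scalerA -signr_addb addbb scale1r. Qed.

Lemma cadjM p q r (A : 'M[K]_(p, q)) (B : 'M[K]_(q, r)) :
  adj (A *m B) = adj B *m adj A.
Proof. by rewrite trmx_mul map_mxM. Qed.

Lemma cadjZ p q a (A : 'M[K]_(p, q)) : adj (a *: A) = Num.conj a *: adj A.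
Proof. by apply/matrixP => i j; rewrite !mxE rmorphM. Qed.

End SignedCommutation.

(* The open-chain bonds P 0, ..., P (M - 2) anticommute exactly with their
   neighbours; P (M - 1) is the bond closing the ring. *)
Record bond_algebra (K : numClosedFieldType) (N M : nat) := BondAlgebra {
  bond : nat -> 'M[K]_N;
  edge : 'M[K]_N;
  bond_sqr : forall n, bond n *m bond n = 1%:M;
  bond_adj : forall n, adj (bond n) = bond n;
  bond_scomm : forall n m, (n.+1 < M)%N -> (m.+1 < M)%N ->
    scomm ((n == m.+1) || (m == n.+1)) (bond n) (bond m);
  bond_closing : forall n, (n.+1 < M)%N ->
    scomm ((n == 0)%N || (n.+2 == M)) (bond n) (bond M.-1);
  edge_sqr : edge *m edge = 1%:M;
  edge_adj : adj edge = edge;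
  edge_bond : forall n, (n.+1 < M)%N -> scomm (n == 0)%N edge (bond n);
  edge_closing : scomm false edge (bond M.-1) }.

Section Majorana.
Variables (K : numClosedFieldType) (T : zmodType) (ph : phases K T).
Variables (N M : nat) (ba : bond_algebra K N M).
Hypothesis M_gt2 : (2 < M)%N.
Local Notation "''I'" := (phI ph).
Local Notation P := (bond ba).
Local Notation Q := (bond ba M.-1).

(** For the Pauli bonds these are Z_0, Y_0, X_0 Z_1, X_0 Y_1, and so on; the factor - i makes them
    self-adjoint involutions. *)
Fixpoint maj n : 'M[K]_N :=
  if n is m.+1 then (- 'I) *: (maj m *m P m) else edge ba.

(** Up to a scalar c_n is the product of [edge] and P_0, ..., P_{n-1}. If n > m + 1, both neighbours
    of P_m occur in it ([edge] playing the left neighbour of P_0) and the two signs cancel; if n is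
    m or m + 1, only the left one occurs. *)
Lemma maj_bond n m : (n < M)%N -> (m.+1 < M)%N ->
  scomm ((n == m) || (n == m.+1)) (maj n) (P m).
Proof.
elim: n m => [|n IH] m nM mM /=.
  by rewrite orbF eq_sym; exact: edge_bond.
have -> : (n.+1 == m) || (n.+1 == m.+1) =
   ((n == m) || (n == m.+1)) (+) ((n == m.+1) || (m == n.+1)).
  by do 4?[case: eqP => ? /=] => //; lia.
apply: scommZ; apply: scommM; first by apply: IH => //; exact: ltnW.
exact: bond_scomm.
Qed.

(** The closing bond anticommutes with P_0 and P_{M-2}. The product c_n contains exactly one of them
    unless n is 0 (none) or M - 1 (both). *)
Lemma maj_closing n : (n < M)%N ->
  scomm ((0 < n)%N && (n.+1 < M)%N) (maj n) Q.
Proof.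
elim: n => [|n IH] nM /=; first exact: edge_closing.
have -> : (n.+2 < M)%N =
   ((0 < n)%N && (n.+1 < M)%N) (+) ((n == 0)%N || (n.+2 == M)).
  rewrite nM andbT; case: n {IH} nM => [|n] nM /=; first by lia.
  by apply/idP/idP; lia.
apply: scommZ; apply: scommM; first by apply: IH => //; exact: ltnW.
exact: bond_closing.
Qed.

Lemma maj_anti n : (n.+1 < M)%N -> maj n *m P n = - (P n *m maj n).
Proof.
move=> nM; have := maj_bond (ltnW nM) nM.
by rewrite /scomm eqxx /= expr1 scaleN1r.
Qed.

Lemma maj_sqr n : (n < M)%N -> maj n *m maj n = 1%:M.
Proof.
elim: n => [|n IH] nM /=; first exact: edge_sqr.
rewrite -scalemxAl -scalemxAr scalerA mulrNN phI_sqr scaleN1r.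
rewrite {1}maj_anti// mulNmx opprK -mulmxA (mulmxA (maj n)) IH ?mul1mx ?bond_sqr//.
exact: ltnW.
Qed.

Lemma maj_adj n : (n < M)%N -> adj (maj n) = maj n.
Proof.
elim: n => [|n IH] nM /=; first exact: edge_adj.
have cI : Num.conj (- 'I) = 'I by rewrite rmorphN /= phI_conj opprK.
rewrite cadjZ cI cadjM bond_adj (IH (ltnW nM)).
by rewrite maj_anti// scalerN scaleNr opprK.
Qed.

Lemma maj_lt_anti n m : (n < m)%N -> (m < M)%N ->
  maj n *m maj m = - (maj m *m maj n).
Proof.
move=> nm mM; suff : scomm true (maj m) (maj n).
  by move=> /scommC; rewrite /scomm expr1 scaleN1r.
elim: m nm mM => // m IH; rewrite ltnS leq_eqVlt => /orP[/eqP -> | nm] mM /=.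
  have pm : P m *m maj m = - (maj m *m P m) by rewrite maj_anti// opprK.
  by rewrite /scomm expr1 scaleN1r -scalemxAl -scalemxAr -mulmxA pm mulmxN scalerN.
rewrite -[true]/(true (+) false); apply: scommZ; apply: scommM.
  by apply: IH => //; exact: ltnW.
have /scommC := @maj_bond n m (ltn_trans nm (ltnW mM)) mM.
by rewrite (ltn_eqF nm) ltn_eqF// ltnW.
Qed.

Lemma maj_acomm n m : (n < M)%N -> (m < M)%N ->
  maj n *m maj m + maj m *m maj n = (2 * (n == m)%:R) *: 1%:M.
Proof.
move=> nM mM; case: (ltngtP n m) => nm.
- by rewrite maj_lt_anti// addNr mulr0 scale0r.
- by rewrite (maj_lt_anti nm)// subrr mulr0 scale0r.
- by rewrite nm maj_sqr// mulr1 scaler_nat mulr2n.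
Qed.

Lemma bond_maj n : (n.+1 < M)%N -> P n *m maj n = (- 'I) *: maj n.+1.
Proof.
move=> nM /=; rewrite maj_anti// scalerA mulrNN phI_sqr scaleN1r opprK //.
Qed.

Lemma bond_majS n : (n.+1 < M)%N -> P n *m maj n.+1 = 'I *: maj n.
Proof.
move=> nM /=; rewrite maj_anti// scalerN scaleNr opprK -scalemxAr mulmxA.
by rewrite bond_sqr mul1mx.
Qed.

(** Bonds are quadratic in the Majorana operators; for even n this writes X_j as a pair, so that the
    XX correlation becomes a four-point function. *)
Lemma bondE n : (n.+1 < M)%N -> P n = 'I *: (maj n *m maj n.+1).
Proof.
move=> nM /=; rewrite -scalemxAr scalerA mulrN phI_sqr opprK scale1r mulmxA.
by rewrite maj_sqr ?mul1mx// ltnW.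
Qed.

End Majorana.

Lemma mulmx_comm_addZ (R : comPzRingType) (N : nat) (A B P : 'M[R]_N) (a : R) :
  A *m P = P *m A -> B *m P = P *m B -> (A + a *: B) *m P = P *m (A + a *: B).
Proof.
by move=> AP BP; rewrite mulmxDl mulmxDr AP -scalemxAl -scalemxAr BP.
Qed.

(** * Conjugation by one layer *)

Section Layer.
Variables (K : numClosedFieldType) (T : zmodType) (ph : phases K T).
Variables (N L : nat) (ba : bond_algebra K N L.*2).
Hypothesis L_gt1 : (1 < L)%N.
Local Notation M := L.*2.
Local Notation "''I'" := (phI ph).
Local Notation re := (phre ph).
Local Notation P := (bond ba).
Local Notation Q := (bond ba M.-1).
Local Notation c := (maj ph ba).

Let M_gt2 : (2 < M)%N. Proof. by move: L_gt1; lia. Qed.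

(** Only neighbours on the ring of bonds anticommute, and since the ring has even length neighbours
    have opposite parity, also across the cut. *)
Lemma bond_parity_comm (b : bool) n m : (n < M)%N -> (m < M)%N ->
  odd n = b -> odd m = b -> P n *m P m = P m *m P n.
Proof.
have scE A B : scomm false A B -> A *m B = B *m A :> 'M[K]_N.
  by rewrite /scomm scale1r.
move=> nM mM on om.
have [nM1|nM1] := ltnP n.+1 M; have [mM1|mM1] := ltnP m.+1 M.
- apply: scE; have := bond_scomm ba nM1 mM1.
  have -> // : (n == m.+1) || (m == n.+1) = false by lia.
- have -> : m = M.-1 by lia.
  apply: scE; have := bond_closing ba nM1.
  have -> // : (n == 0)%N || (n.+2 == M) = false by lia.
- have -> : n = M.-1 by lia.
  apply/esym/scE; have := bond_closing ba mM1.
  have -> // : (m == 0)%N || (m.+2 == M) = false by lia.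
- by have -> : n = m by lia.
Qed.

Definition layer (e : bool) : 'M[K]_N := \sum_(j < L) P (j.*2 + e).

Definition evol e t : 'M[K]_N := expmx (('I * re t) *: layer e).

(** The only open bond of parity [e] that anticommutes with c_n; [nbr e n] is the index of the other
    Majorana operator on that bond. Both are meaningful for 0 < n only. *)
Definition layer_bond (e : bool) n := if odd n == e then n else n.-1.
Definition nbr (e : bool) n := if odd n == e then n.+1 else n.-1.

(** The angle is doubled because moving c_n past the layer changes the sign of i t P, a difference
    of 2 i t P. It is written [t + t] since [T] is only an additive group. *)
Definition rotmaj e t n : 'M[K]_N := phcos ph (t + t) *: c n +
  (if odd n == e then - phsin ph (t + t) else phsin ph (t + t)) *: c (nbr e n).

Definition closing_gate (e : bool) t : 'M[K]_N :=
  if e then gate ph t Q else 1%:M.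

Lemma layer_resolvable e t : resolvable ph (('I * re t) *: layer e).
Proof.
have [] // := @sum_involutions _ _ ph N _ (index_enum 'I_L)
  (fun j : 'I_L => P (j.*2 + e)) t.
- by move=> i; exact: bond_sqr.
- move=> i j; have := ltn_ord i; have := ltn_ord j => jL iL.
  by apply: (@bond_parity_comm e); case: (e) => //=; lia.
- by move=> i; exact: bond_adj.
Qed.

Lemma evol_unitary e t : adj (evol e t) *m evol e t = 1%:M.
Proof.
have [] // := @sum_involutions _ _ ph N _ (index_enum 'I_L)
  (fun j : 'I_L => P (j.*2 + e)) t.
- by move=> i; exact: bond_sqr.
- move=> i j; have := ltn_ord i; have := ltn_ord j => jL iL.
  by apply: (@bond_parity_comm e); case: (e) => //=; lia.
- by move=> i; exact: bond_adj.
Qed.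

Lemma layer_comm (e : bool) n : (n < M)%N -> odd n = e ->
  layer e *m P n = P n *m layer e.
Proof.
move=> nM on; rewrite /layer mulmx_suml mulmx_sumr; apply: eq_bigr => j _.
have := ltn_ord j => jL.
by apply: (@bond_parity_comm e) => //; case: (e) => //=; lia.
Qed.

(** Crossing the layer changes the sign of the bonds that anticommute with c_n: one open bond and,
    in a ZZ layer only, the closing bond. *)
Lemma maj_layer (e : bool) n : (0 < n)%N -> (n.+1 < M)%N ->
  c n *m layer e = (layer e - 2 *: P (layer_bond e n) - (2 * e%:R) *: Q) *m c n.
Proof.
move=> n0 nM; pose b := layer_bond e n.
have bM : (b.+1 < M)%N by rewrite /b /layer_bond; case: ifP; lia.
have ob : odd b = e by rewrite /b /layer_bond; case: ifP; move: n0; case: (e); lia.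
have h (j : 'I_L) : c n *m P (j.*2 + e) =
   (P (j.*2 + e) - (2 * (j.*2 + e == b)%N%:R) *: P b
     - (2 * (e && (j == L.-1 :> nat))%:R) *: Q) *m c n.
  have jL := ltn_ord j.
  have [jM|jM] := ltnP (j.*2 + e).+1 M.
    have -> : e && (j == L.-1 :> nat) = false by move: jM; case: (e) => //=; lia.
    rewrite mulr0 scale0r subr0.
    have := maj_bond ph ba M_gt2 (ltnW nM) jM; rewrite /scomm => ->.
    have -> : (n == j.*2 + e)%N || (n == (j.*2 + e).+1)%N = (j.*2 + e == b)%N.
      by rewrite /b /layer_bond; case: ifP; move: n0; case: (e) => /=; lia.
    have [<-|_] := eqVneq (j.*2 + e)%N b.
      rewrite expr1 scaleN1r -mulNmx; congr (_ *m _).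
      by rewrite mulr1 scaler_nat mulr2n opprD addrA subrr sub0r.
    by rewrite mulr0 scale0r subr0 expr0 scale1r.
  have e1 : e by move: jM; case: (e) => //=; lia.
  have jl : j == L.-1 :> nat by move: jM; rewrite e1; lia.
  have -> : (j.*2 + e)%N = M.-1 by rewrite (eqP jl) e1; lia.
  rewrite e1 jl mulr1.
  have -> : (M.-1 == b)%N = false by lia.
  have := maj_closing ph ba M_gt2 (ltnW nM); rewrite /scomm n0 nM expr1 scaleN1r => ->.
  rewrite mulr0 scale0r subr0 -mulNmx; congr (_ *m _).
  by rewrite scaler_nat mulr2n opprD addrA subrr sub0r.
rewrite /layer mulmx_sumr (eq_bigr _ (fun j _ => h j)) -mulmx_suml !sumrB.
congr ((_ - _ - _) *m _).
  rewrite -scaler_suml -mulr_sumr -natr_sum; congr (_ *: _).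
  have bL : (b./2 < L)%N by lia.
  rewrite (bigD1 (Ordinal bL)) //= big1 => [|j].
    by rewrite (_ : (_ == b)%N) ?mulr1//; move: ob; case: (e); lia.
  by rewrite -val_eqE /= => jb; rewrite (_ : (_ == b)%N = false)//; move: ob; case: (e); lia.
rewrite -scaler_suml -mulr_sumr -natr_sum; congr ((_ * _%:R) *: _).
case: (e) => /=; last by rewrite big1.
have lL : (L.-1 < L)%N by lia.
rewrite (bigD1 (Ordinal lL)) //= eqxx big1 // => j.
by rewrite -val_eqE /= => /negPf ->.
Qed.

Lemma rot_gate e t n : (0 < n)%N -> (n.+1 < M)%N ->
  gate ph (- (t + t)) (P (layer_bond e n)) *m c n = rotmaj e t n.
Proof.
move=> n0 nM; rewrite /gate mulmxDl -!scalemxAl mul1mx phcosN phsinN /rotmaj.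
rewrite /layer_bond /nbr; case: ifP => _.
  rewrite (bond_maj ph ba M_gt2 nM) scalerA; congr (_ + _ *: _).
  transitivity (('I * 'I) * phsin ph (t + t)); first by ring.
  by rewrite phI_sqr mulN1r.
have nM' : (n.-1.+1 < M)%N by rewrite prednK// ltnW.
have := bond_majS ph ba M_gt2 nM'; rewrite prednK// => ->.
rewrite scalerA; congr (_ + _ *: _).
transitivity (- ('I * 'I) * phsin ph (t + t)); first by ring.
by rewrite phI_sqr opprK mul1r.
Qed.

(** By [maj_layer], c_n intertwines the layer with a copy in which one or two bonds have changed
    sign. The exponential of the copy is that of the layer times one gate for each changed bond. *)
Lemma maj_evol (e : bool) t n : (0 < n)%N -> (n.+1 < M)%N ->
  c n *m evol e t = evol e t *m (closing_gate e (- (t + t)) *m rotmaj e t n).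
Proof.
move=> n0 nM; pose b := layer_bond e n.
have bM : (b.+1 < M)%N by rewrite /b /layer_bond; case: ifP; lia.
have ob : odd b = e by rewrite /b /layer_bond; case: ifP; move: n0; case: (e); lia.
pose A : 'M[K]_N := ('I * re t) *: layer e.
have rA : resolvable ph A by exact: layer_resolvable.
have Ac m : (m < M)%N -> odd m = e -> A *m P m = P m *m A.
  by move=> mM om; rewrite /A -scalemxAl -scalemxAr layer_comm.
have Ec m s : (m < M)%N -> odd m = e ->
   gate ph s (P m) *m evol e t = evol e t *m gate ph s (P m).
  move=> mM om; apply/esym/gate_comm.
  by apply/esym; apply: (expmx_intertwine rA rA); rewrite Ac.
have re2 : re (- (t + t)) = - (2 * re t).
  by rewrite phreN phreD mulr_natl mulr2n.
have bQ : odd M.-1 = true by lia.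
have ME : (M.-1 < M)%N by lia.
(* [A1] changes the sign of the closing bond and [A2] also that of bond [b]: subtracting 2 i t P
   turns i t P into - i t P. *)
pose A1 : 'M[K]_N := if e then A + ('I * re (- (t + t))) *: Q else A.
have rA1 : resolvable ph A1.
  rewrite /A1; case: ifP => // et; apply: resolvable_add => //.
    exact: bond_sqr.
  by apply: Ac => //; rewrite et.
have eA1 : expmx A1 = closing_gate e (- (t + t)) *m evol e t.
  rewrite /A1 /closing_gate /evol -/A; case: ifP => et; last by rewrite mul1mx.
  apply: expmx_add => //; first exact: bond_sqr.
  by apply: Ac => //; rewrite et.
have A1c : A1 *m P b = P b *m A1.
  rewrite /A1; case: ifP => et; last by apply: Ac => //; exact: ltnW.
  apply: mulmx_comm_addZ; first by apply: Ac => //; exact: ltnW.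
  exact: (bond_parity_comm ME (ltnW bM) (etrans bQ (esym et)) ob).
pose A2 : 'M[K]_N := A1 + ('I * re (- (t + t))) *: P b.
have rA2 : resolvable ph A2 by apply: resolvable_add => //; exact: bond_sqr.
have cA : c n *m A = A2 *m c n.
  rewrite /A -scalemxAr maj_layer// /A2 /A1 re2 scalemxAl; congr (_ *m _).
  rewrite !scalerBr !scalerA -/A -/b; case: (e).
    rewrite -addrA [X in _ + X]addrC addrA mulr1.
    by rewrite !mulrN !scaleNr; congr (_ - _ *: _ - _ *: _); ring.
  by rewrite !mulr0 scale0r subr0 mulrN scaleNr; congr (_ - _ *: _); ring.
rewrite (expmx_intertwine rA rA2 cA) expmx_add//; last exact: bond_sqr.
rewrite eA1 -rot_gate// -/b !mulmxA; congr (_ *m _).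
move: Ec; set E := evol e t => Ec; rewrite /closing_gate; case: ifP => et.
  have gQb r : gate ph r (P b) *m gate ph r Q = gate ph r Q *m gate ph r (P b).
    apply: gate_comm; apply/esym/gate_comm.
    exact: (bond_parity_comm ME (ltnW bM) (etrans bQ (esym et)) ob).
  rewrite gQb -(mulmxA (gate _ _ Q)) Ec ?(ltnW bM)//.
  by rewrite (mulmxA (gate _ _ Q)) Ec// bQ et.
by rewrite !mulmx1 Ec// ltnW.
Qed.

(** The bounds keep n and its neighbour strictly inside the chain, where Majorana operators
    anticommute with the closing bond. *)
Lemma rot_closing (e : bool) t s n : (1 < n)%N -> (n.+2 < M)%N ->
  rotmaj e t n *m closing_gate e s = closing_gate e (- s) *m rotmaj e t n.
Proof.
move=> n1 nM; rewrite /closing_gate; case: ifP => _; last by rewrite mulmx1 mul1mx.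
apply: gate_anticomm.
have h m : (0 < m)%N -> (m.+1 < M)%N -> c m *m Q = - (Q *m c m).
  move=> m0 mM; have := maj_closing ph ba M_gt2 (ltnW mM).
  by rewrite /scomm m0 mM expr1 scaleN1r.
rewrite /rotmaj mulmxDl mulmxDr -!scalemxAl -!scalemxAr !h ?scalerN ?opprD//.
all: by rewrite /nbr; try case: ifP; lia.
Qed.

(** Each factor leaves a closing gate. The gate of the second changes the sign of its angle when it
    crosses the first rotated operator, and then cancels the gate of the first. *)
Lemma maj2_evol (e : bool) t n m :
  (1 < n)%N -> (n.+2 < M)%N -> (1 < m)%N -> (m.+2 < M)%N ->
  c n *m c m *m evol e t = evol e t *m (rotmaj e t n *m rotmaj e t m).
Proof.
move=> n1 nM m1 mM.
rewrite -mulmxA maj_evol; [|lia..].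
rewrite (mulmxA (c n)) maj_evol; [|lia..].
rewrite -!mulmxA; congr (_ *m _); rewrite [in LHS](mulmxA (rotmaj e t n)) rot_closing//.
rewrite opprK !mulmxA; congr (_ *m _).
have -> : closing_gate e (- (t + t)) *m closing_gate e (t + t) = 1%:M.
  rewrite /closing_gate; case: (e); last by rewrite mulmx1.
  by apply: gateNK; exact: bond_sqr.
by rewrite mul1mx.
Qed.

End Layer.

(** * Wick's formula *)

Section Expectation.
Variables (K : numClosedFieldType) (N : nat).
Implicit Types (v : 'cV[K]_N) (A B x y : 'M[K]_N).

Definition ev v A : K := (adj v *m A *m v) 0 0.

Lemma evD v A B : ev v (A + B) = ev v A + ev v B.
Proof. by rewrite /ev mulmxDr mulmxDl mxE. Qed.

Lemma evZ v a A : ev v (a *: A) = a * ev v A.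
Proof. by rewrite /ev -scalemxAr -scalemxAl mxE. Qed.

Lemma evN v A : ev v (- A) = - ev v A.
Proof. by rewrite -scaleN1r evZ mulN1r. Qed.

Lemma evB v A B : ev v (A - B) = ev v A - ev v B.
Proof. by rewrite evD evN. Qed.

Lemma ev_adj v A : ev v (adj A) = Num.conj (ev v A).
Proof.
have adjK p q (B : 'M[K]_(p, q)) : adj (adj B) = B.
  by apply/matrixP => i j; rewrite !mxE conjCK.
have <- : adj (adj v *m A *m v) 0 0 = Num.conj (ev v A) by rewrite /ev !mxE.
by rewrite /ev !cadjM adjK mulmxA.
Qed.

Lemma ev_unitary v E A B : adj E *m E = 1%:M -> A *m E = E *m B ->
  ev (E *m v) A = ev v B.
Proof.
move=> EE AE; rewrite /ev cadjM -!mulmxA (mulmxA A) AE -!mulmxA.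
by rewrite (mulmxA (adj E)) EE mul1mx.
Qed.

Definition wick v x1 x2 x3 x4 :=
  ev v (x1 *m x2 *m (x3 *m x4)) =
  ev v (x1 *m x2) * ev v (x3 *m x4) - ev v (x1 *m x3) * ev v (x2 *m x4)
  + ev v (x1 *m x4) * ev v (x2 *m x3).

(** Both sides of Wick's formula are linear in each of the four arguments, so it survives rotations
    of the operators. *)
Lemma wick1 v a b x y x2 x3 x4 : wick v x x2 x3 x4 -> wick v y x2 x3 x4 ->
  wick v (a *: x + b *: y) x2 x3 x4.
Proof.
rewrite /wick => hx hy; rewrite !mulmxDl -!scalemxAl !evD !evZ hx hy.
by ring.
Qed.

Lemma wick2 v a b x y x1 x3 x4 : wick v x1 x x3 x4 -> wick v x1 y x3 x4 ->
  wick v x1 (a *: x + b *: y) x3 x4.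
Proof.
rewrite /wick => hx hy.
rewrite !(mulmxDl, mulmxDr) -!(scalemxAl, scalemxAr) !evD !evZ hx hy.
by ring.
Qed.

Lemma wick3 v a b x y x1 x2 x4 : wick v x1 x2 x x4 -> wick v x1 x2 y x4 ->
  wick v x1 x2 (a *: x + b *: y) x4.
Proof.
rewrite /wick => hx hy.
rewrite !(mulmxDl, mulmxDr) -!(scalemxAl, scalemxAr) !evD !evZ hx hy.
by ring.
Qed.

Lemma wick4 v a b x y x1 x2 x3 : wick v x1 x2 x3 x -> wick v x1 x2 x3 y ->
  wick v x1 x2 x3 (a *: x + b *: y).
Proof.
rewrite /wick => hx hy.
rewrite !(mulmxDl, mulmxDr) -!(scalemxAl, scalemxAr) !evD !evZ hx hy.
by ring.
Qed.

(** The subtracted product is the first of the three contractions, and i^2 = -1 reverses the signs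
    of the other two. *)
Lemma wick_connected v i x1 x2 x3 x4 : i * i = -1 -> wick v x1 x2 x3 x4 ->
  ev v (i *: (x1 *m x2) *m (i *: (x3 *m x4)))
    - ev v (i *: (x1 *m x2)) * ev v (i *: (x3 *m x4)) =
  ev v (x1 *m x3) * ev v (x2 *m x4) - ev v (x1 *m x4) * ev v (x2 *m x3).
Proof.
rewrite /wick => i2 w; rewrite -scalemxAl -scalemxAr !evZ w.
transitivity (i * i * (ev v (x1 *m x4) * ev v (x2 *m x3)
  - ev v (x1 *m x3) * ev v (x2 *m x4))); first by ring.
by rewrite i2; ring.
Qed.

End Expectation.

(** * The initial state and its evolution *)

Section Wick.
Variables (K : numClosedFieldType) (T : zmodType) (ph : phases K T).
Variables (N L : nat) (ba : bond_algebra K N L.*2).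
Hypothesis L_gt1 : (1 < L)%N.
Variable v : 'cV[K]_N.
Local Notation M := L.*2.
Local Notation "''I'" := (phI ph).
Local Notation P := (bond ba).
Local Notation c := (maj ph ba).
Hypothesis v_norm : ev v 1%:M = 1.
Hypothesis v_stab : forall n, odd n -> (n.+1 < M)%N -> P n *m v = v.

Let M_gt2 : (2 < M)%N. Proof. by move: L_gt1; lia. Qed.

(* The indices whose light cone after s layers avoids both ends of the chain. *)
Definition bulk s n := (s < n)%N && (n + s + 1 < M)%N.

(** The bond i c_{2j+1} c_{2j+2} fixes [v], so on [v] each Majorana operator is a multiple of the
    one with which it shares an odd bond; [kap] is that multiple. *)
Definition partner n := if odd n then n.+1 else n.-1.
Definition kap n : K := if odd n then 'I else - 'I.

Lemma maj_partner n : bulk 0 n -> c n *m v = kap n *: (c (partner n) *m v).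
Proof.
move=> /andP[n0 nM]; rewrite /kap /partner.
have h m : odd m -> (m.+1 < M)%N -> c m *m v = 'I *: (c m.+1 *m v).
  move=> om mM; rewrite /= -scalemxAl -mulmxA v_stab// scalerA mulrN phI_sqr.
  by rewrite opprK scale1r.
case: ifP => on; first by apply: h => //; lia.
have e : n.-1.+1 = n by lia.
have := h n.-1; rewrite e => ->; [|lia..].
by rewrite scalerA mulNr phI_sqr opprK scale1r.
Qed.

Lemma partner_bulk n : bulk 0 n -> (partner n < M)%N.
Proof. by rewrite /bulk /partner; case: ifP; lia. Qed.

(** Up to normalisation a creation operator: its adjoint kills [v], while on [v] itself it acts as 2
    c_n. *)
Definition creat n : 'M[K]_N := c n + kap n *: c (partner n).

Lemma creat_v n : bulk 0 n -> creat n *m v = 2 *: (c n *m v).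
Proof.
by move=> bn; rewrite /creat mulmxDl -scalemxAl -maj_partner// scaler_nat mulr2n.
Qed.

Lemma v_creat n : bulk 0 n -> adj v *m creat n = 0.
Proof.
move=> bn; have nM : (n < M)%N by move: bn; rewrite /bulk; lia.
have h := congr1 (fun A : 'cV[K]_N => adj A) (maj_partner bn).
rewrite cadjZ !cadjM !maj_adj// ?partner_bulk// in h.
rewrite /creat mulmxDr h -scalemxAr -scalerDl.
(* [kap n] is imaginary, so the two halves of [creat n], which agree on [v], cancel on its
   adjoint. *)
have -> : Num.conj (kap n) = - kap n.
  by rewrite /kap; case: ifP; rewrite ?rmorphN /= phI_conj// opprK.
by rewrite addNr scale0r.
Qed.

(** Half the scalar anticommutator of c_n and [creat m], and therefore the two-point function of the
    initial state. *)
Definition pair0 n m : K := (n == m)%:R + kap m * (n == partner m)%:R.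

Lemma maj_creat n m : (n < M)%N -> bulk 0 m ->
  c n *m creat m = (2 * pair0 n m) *: 1%:M - creat m *m c n.
Proof.
move=> nM bm; have mM : (m < M)%N by move: bm; rewrite /bulk; lia.
apply/eqP; rewrite -subr_eq opprK; apply/eqP.
rewrite /creat mulmxDr mulmxDl -scalemxAr -scalemxAl addrACA -scalerDr.
rewrite !maj_acomm// ?partner_bulk// scalerA -scalerDl /pair0; congr (_ *: _).
by ring.
Qed.

Lemma ev_creatl m A : bulk 0 m -> ev v (creat m *m A) = 0.
Proof. by move=> bm; rewrite /ev mulmxA v_creat// !mul0mx mxE. Qed.

Lemma ev_creatr m A : bulk 0 m -> ev v (A *m c m) = 2^-1 * ev v (A *m creat m).
Proof.
move=> bm; have n2 : (2 : K) != 0 by rewrite pnatr_eq0.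
have -> : ev v (A *m creat m) = 2 * ev v (A *m c m).
  by rewrite /ev -!mulmxA creat_v// -!scalemxAr [LHS]mxE.
by rewrite mulrA mulVf ?mul1r.
Qed.

Lemma ev2_0 n m : bulk 0 n -> bulk 0 m -> ev v (c n *m c m) = pair0 n m.
Proof.
move=> bn bm; have nM : (n < M)%N by move: bn; rewrite /bulk; lia.
have n2 : (2 : K) != 0 by rewrite pnatr_eq0.
rewrite ev_creatr// maj_creat// evB evZ v_norm ev_creatl//.
by rewrite subr0 mulr1 mulrA mulVf// mul1r.
Qed.

(* Moving the creation part of the last factor to the left, where the state kills
   it, leaves one contraction for each factor that it passes. *)
Lemma wick0 n1 n2 n3 n4 : bulk 0 n1 -> bulk 0 n2 -> bulk 0 n3 -> bulk 0 n4 ->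
  wick v (c n1) (c n2) (c n3) (c n4).
Proof.
move=> b1 b2 b3 b4; have bM n : bulk 0 n -> (n < M)%N by rewrite /bulk; lia.
have two : (2 : K) != 0 by rewrite pnatr_eq0.
have swap A n : bulk 0 n -> A *m c n *m creat n4 =
    (2 * pair0 n n4) *: A - A *m creat n4 *m c n.
  move=> bn; rewrite -mulmxA maj_creat ?bM// mulmxBr -scalemxAr mulmx1.
  by rewrite mulmxA.
have cr A : ev v (A *m c n4) = 2^-1 * ev v (A *m creat n4) := ev_creatr A b4.
have cl A : ev v (creat n4 *m A) = 0 := ev_creatl A b4.
have c1 := maj_creat (bM _ b1) b4.
rewrite /wick (mulmxA _ (c n3)) cr !ev2_0//.
move: (creat n4) swap cl c1 {cr} => D swap cl c1.
rewrite swap// swap// c1 !mulmxBl -!scalemxAl mul1mx.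
rewrite !evB !evZ -!mulmxA cl !ev2_0//.
by field.
Qed.

Variable t : nat -> T.

Fixpoint states s : 'cV[K]_N :=
  if s is r.+1 then evol ph ba (odd r) (t r) *m states r else v.

Definition rcos s : K := phcos ph (t s + t s).
Definition rsin s n : K :=
  if odd n == odd s then - phsin ph (t s + t s) else phsin ph (t s + t s).

Lemma bulkS s n : bulk s.+1 n -> [/\ bulk s n, bulk s (nbr (odd s) n),
   (1 < n)%N & (n.+2 < M)%N].
Proof. by rewrite /bulk /nbr => h; split; try case: ifP; lia. Qed.

(** [G] is left open so that the Fourier integrals [corr] can be substituted later, while this
    section stays over an abstract field. *)
Lemma ev2_states (G : nat -> nat -> nat -> K) :
  (forall n m, bulk 0 n -> bulk 0 m -> G 0%N n m = pair0 n m) ->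
  (forall s n m, bulk s.+1 n -> bulk s.+1 m -> G s.+1 n m =
     rcos s * rcos s * G s n m + rcos s * rsin s m * G s n (nbr (odd s) m) +
     rsin s n * rcos s * G s (nbr (odd s) n) m +
     rsin s n * rsin s m * G s (nbr (odd s) n) (nbr (odd s) m)) ->
  forall s n m, bulk s n -> bulk s m -> ev (states s) (c n *m c m) = G s n m.
Proof.
move=> G0 GS; elim=> [|s IH] n m bn bm; first by rewrite ev2_0// G0.
have [bn1 bn2 n1 nM] := bulkS bn; have [bm1 bm2 m1 mM] := bulkS bm.
rewrite /= (ev_unitary _ (evol_unitary ph ba L_gt1 _ _)
  (maj2_evol ph ba L_gt1 _ _ n1 nM m1 mM)) GS// -!IH//.
rewrite /rotmaj /rcos /rsin.
rewrite !(mulmxDl, mulmxDr) -!(scalemxAl, scalemxAr) !evD !evZ.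
by ring.
Qed.

(** The four operators cross a layer two at a time, since a single one would leave a closing gate
    behind. *)
Lemma wick_states s n1 n2 n3 n4 :
  bulk s n1 -> bulk s n2 -> bulk s n3 -> bulk s n4 ->
  wick (states s) (c n1) (c n2) (c n3) (c n4).
Proof.
elim: s n1 n2 n3 n4 => [|s IH] n1 n2 n3 n4; first exact: wick0.
move=> /bulkS[b1 b1' l1 u1] /bulkS[b2 b2' l2 u2] /bulkS[b3 b3' l3 u3].
move=> /bulkS[b4 b4' l4 u4].
have E2 n m : (1 < n)%N -> (n.+2 < M)%N -> (1 < m)%N -> (m.+2 < M)%N ->
   ev (evol ph ba (odd s) (t s) *m states s) (c n *m c m) =
   ev (states s) (rotmaj ph ba (odd s) (t s) n *m rotmaj ph ba (odd s) (t s) m).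
  move=> *; apply: ev_unitary; first exact: evol_unitary.
  exact: maj2_evol.
rewrite /wick /= !E2//.
have -> : ev (evol ph ba (odd s) (t s) *m states s)
   (c n1 *m c n2 *m (c n3 *m c n4)) = ev (states s)
   (rotmaj ph ba (odd s) (t s) n1 *m rotmaj ph ba (odd s) (t s) n2 *m
    (rotmaj ph ba (odd s) (t s) n3 *m rotmaj ph ba (odd s) (t s) n4)).
  apply: ev_unitary; first exact: evol_unitary.
  by rewrite -mulmxA maj2_evol// mulmxA maj2_evol// -mulmxA.
change (wick (states s) (rotmaj ph ba (odd s) (t s) n1)
  (rotmaj ph ba (odd s) (t s) n2) (rotmaj ph ba (odd s) (t s) n3)
  (rotmaj ph ba (odd s) (t s) n4)).
by rewrite /rotmaj; apply: wick1; apply: wick2; apply: wick3; apply: wick4; apply: IH.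
Qed.

End Wick.

(** * Pauli operators *)

Section Monomial.
Variables (K : numClosedFieldType) (F : finType).
Implicit Types (f : F -> F) (g : F -> K).

(** Monomial matrices. The Pauli operators and the translation are of this form, which reduces their
    algebra to composing maps on configurations. *)
Definition mono f g : 'M[K]_#|F| :=
  \matrix_(s, t) (g (enum_val s) *+ (enum_val t == f (enum_val s))).

Lemma mono_mul f g f' g' :
  mono f g *m mono f' g' = mono (f' \o f) (fun u => g u * g' (f u)).
Proof.
apply/matrixP => s t; rewrite !mxE (bigD1 (enum_rank (f (enum_val s)))) //= big1.
  by rewrite !mxE enum_rankK eqxx mulr1n addr0 mulrnAr.
move=> r rs; rewrite !mxE; case: eqP => [e|_]; last by rewrite mulr0n mul0r.
by move: rs; rewrite -e enum_valK eqxx.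
Qed.

Lemma eq_mono f g f' g' : f =1 f' -> g =1 g' -> mono f g = mono f' g'.
Proof. by move=> ff gg; apply/matrixP => s t; rewrite !mxE ff gg. Qed.

Lemma mono1 : mono id (fun=> 1) = 1%:M.
Proof. by apply/matrixP => s t; rewrite !mxE (inj_eq enum_val_inj) eq_sym. Qed.

Lemma mono_adj f f' g : cancel f f' -> cancel f' f ->
  adj (mono f g) = mono f' (fun u => Num.conj (g (f' u))).
Proof.
move=> fK f'K; apply/matrixP => s t; rewrite !mxE.
have -> : (enum_val t == f' (enum_val s)) = (enum_val s == f (enum_val t)).
  by apply/eqP/eqP => [->|->]; rewrite ?f'K ?fK.
by case: eqP => [->|_]; rewrite ?mulr0n ?rmorph0 // !mulr1n fK.
Qed.

Lemma mono_delta f g w w' : (forall u, (f u == w) = (u == w')) ->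
  mono f g *m delta_mx (enum_rank w) 0 =
  g w' *: (delta_mx (enum_rank w') 0 : 'cV[K]_#|F|).
Proof.
move=> fw; apply/matrixP => s t; rewrite !mxE (bigD1 (enum_rank w)) //= big1.
  rewrite !mxE enum_rankK eqxx (eq_sym w) fw (ord1 t) eqxx andbT mulr1 addr0.
  have [<-|ne] := eqVneq (enum_val s) w'; first by rewrite enum_valK eqxx mulr1.
  have -> : (s == enum_rank w') = false.
    by apply/eqP => e; move: ne; rewrite e enum_rankK eqxx.
  by rewrite mulr0.
by move=> r rw; rewrite !mxE (negPf rw) mulr0.
Qed.

End Monomial.

Section Pauli.
Variables (K : numClosedFieldType) (L' : nat).
Local Notation L := L'.+1.
Local Notation N := #|config L|.
Implicit Types (i j k : 'I_L) (u : config L).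

Definition flip j u : config L :=
  [ffun i => if i == j then (if u i == ord0 then ord_max else ord0) else u i].

Definition zsign j u : K := (-1) ^+ (u j).

Definition Xm j : 'M[K]_N := mono (flip j) (fun=> 1).
Definition Zm j : 'M[K]_N := mono id (zsign j).

Lemma I2_cases (a : 'I_2) : a = ord0 \/ a = ord_max.
Proof. by case: a => [[|[|]]] // p; [left|right]; apply/val_inj. Qed.

Lemma flipK j : involutive (flip j).
Proof.
move=> u; apply/ffunP => i; rewrite !ffunE; case: (i == j) => //.
by case: (I2_cases (u i)) => ->.
Qed.

Lemma flipC j k u : flip j (flip k u) = flip k (flip j u).
Proof.
by apply/ffunP => i; rewrite !ffunE; case: (i == j); case: (i == k).
Qed.

Lemma zsign_flip j k u : zsign k (flip j u) = (-1) ^+ (j == k) * zsign k u.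
Proof.
rewrite /zsign ffunE eq_sym; case: eqP => _; last by rewrite mul1r.
by case: (I2_cases (u k)) => -> /=; rewrite ?expr0 ?expr1 ?mulr1 ?mulrNN ?mulr1.
Qed.

Lemma zsign_sqr j u : zsign j u * zsign j u = 1.
Proof. by rewrite /zsign -exprMn mulrNN mulr1 expr1n. Qed.

Lemma Xm_sqr j : Xm j *m Xm j = 1%:M.
Proof.
rewrite mono_mul -mono1; apply: eq_mono => u /=; first exact: flipK.
by rewrite mulr1.
Qed.

Lemma Zm_sqr j : Zm j *m Zm j = 1%:M.
Proof. by rewrite mono_mul -mono1; apply: eq_mono => u //=; exact: zsign_sqr. Qed.

Lemma Xm_adj j : adj (Xm j) = Xm j.
Proof.
rewrite (mono_adj _ (flipK j) (flipK j)); apply: eq_mono => u //.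
exact: rmorph1.
Qed.

Lemma Zm_adj j : adj (Zm j) = Zm j.
Proof.
rewrite (@mono_adj _ _ id id) //; apply: eq_mono => u //.
by rewrite /zsign rmorphXn /= rmorphN1.
Qed.

Lemma Xm_scomm j k : scomm false (Xm j) (Xm k).
Proof.
rewrite /scomm expr0 scale1r !mono_mul; apply: eq_mono => u //=.
exact: flipC.
Qed.

Lemma Zm_scomm j k : scomm false (Zm j) (Zm k).
Proof.
rewrite /scomm expr0 scale1r !mono_mul; apply: eq_mono => u //=.
exact: mulrC.
Qed.

Lemma Zm_Xm_scomm j k : scomm (j == k) (Zm k) (Xm j).
Proof.
rewrite /scomm !mono_mul; apply/matrixP => s t; rewrite !mxE /=.
by rewrite zsign_flip mulr1 mul1r -mulrnAr mulrA -signr_addb addbb mul1r.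
Qed.

(* Since inord sends the out-of-range L to ord0, the bond numbered 2L - 1 is
   Z_{L-1} Z_0. *)
Definition pauli_bond n : 'M[K]_N :=
  if odd n then Zm (inord n./2) *m Zm (inord n./2.+1) else Xm (inord n./2).

Lemma pauli_bond_sqr n : pauli_bond n *m pauli_bond n = 1%:M.
Proof.
rewrite /pauli_bond; case: ifP => _; last exact: Xm_sqr.
have := Zm_scomm (inord n./2.+1) (inord n./2); rewrite /scomm expr0 scale1r => e.
by rewrite -mulmxA (mulmxA (Zm (inord n./2.+1))) e -mulmxA Zm_sqr mulmx1 Zm_sqr.
Qed.

Lemma pauli_bond_adj n : adj (pauli_bond n) = pauli_bond n.
Proof.
rewrite /pauli_bond; case: ifP => _; last exact: Xm_adj.
have := Zm_scomm (inord n./2.+1) (inord n./2); rewrite /scomm expr0 scale1r => e.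
by rewrite cadjM !Zm_adj e.
Qed.

Lemma ZZ_scomm j k j' k' : scomm false (Zm j *m Zm k) (Zm j' *m Zm k').
Proof.
rewrite -[false]/(false (+) false); apply: scommM;
apply: scommC; rewrite -[false]/(false (+) false); apply: scommM; exact: Zm_scomm.
Qed.

Lemma ZZ_X_scomm i j k : scomm ((i == j) (+) (i == k)) (Zm j *m Zm k) (Xm i).
Proof. by apply: scommM; exact: Zm_Xm_scomm. Qed.

Lemma inord_eq n m : (n < L)%N -> (m < L)%N ->
  (inord n == inord m :> 'I_L) = (n == m).
Proof. by move=> nL mL; rewrite -val_eqE /= !inordK. Qed.

Lemma inord_out : inord L = ord0 :> 'I_L.
Proof. by apply/val_inj; rewrite /inord val_insubd ltnn. Qed.

Lemma pauli_bond_scomm n m : (n.+1 < L.*2)%N -> (m.+1 < L.*2)%N ->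
  scomm ((n == m.+1) || (m == n.+1)) (pauli_bond n) (pauli_bond m).
Proof.
have h a b : (a.+1 < L.*2)%N -> (b.+1 < L.*2)%N -> odd a -> ~~ odd b ->
    scomm ((a == b.+1) || (b == a.+1)) (Zm (inord a./2) *m Zm (inord a./2.+1))
    (Xm (inord b./2)).
  move=> aL bL oa ob; have := ZZ_X_scomm (inord b./2) (inord a./2) (inord a./2.+1).
  rewrite !inord_eq; [|lia..].
  have -> // : (b./2 == a./2) (+) (b./2 == a./2.+1) = (a == b.+1) || (b == a.+1).
  by do 4?[case: eqP => ? /=] => //; lia.
move=> nL mL; rewrite /pauli_bond.
case: (boolP (odd n)) => on; case: (boolP (odd m)) => om.
- have -> : (n == m.+1) || (m == n.+1) = false by lia.
  exact: ZZ_scomm.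
- exact: h.
- by rewrite orbC; apply: scommC; exact: h.
- have -> : (n == m.+1) || (m == n.+1) = false by lia.
  exact: Xm_scomm.
Qed.

Hypothesis L_gt1 : (1 < L)%N.

(** Z_{L-1} Z_0 meets only X_0 and X_{L-1} among the X_j, and L > 1 keeps these two sites
    distinct. *)
Lemma pauli_bond_closing n : (n.+1 < L.*2)%N ->
  scomm ((n == 0)%N || (n.+2 == L.*2)) (pauli_bond n) (pauli_bond (L.*2).-1).
Proof.
move=> nL; rewrite {2}/pauli_bond.
have -> : odd (L.*2).-1 = true by lia.
have -> : (L.*2).-1./2 = L' by lia.
rewrite inord_out /pauli_bond; case: (boolP (odd n)) => on.
  have -> : (n == 0)%N || (n.+2 == L.*2) = false by lia.
  exact: ZZ_scomm.
apply: scommC; have := ZZ_X_scomm (inord n./2) (inord L') ord0.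
have -> : ord0 = inord 0 :> 'I_L by apply/val_inj; rewrite /= inordK.
rewrite !inord_eq; [|lia..].
have -> // : (n./2 == L') (+) (n./2 == 0)%N = (n == 0)%N || (n.+2 == L.*2).
by do 4?[case: eqP => ? /=] => //; lia.
Qed.

Lemma edge_pauli_bond n : (n.+1 < L.*2)%N ->
  scomm (n == 0)%N (Zm (inord 0)) (pauli_bond n).
Proof.
move=> nL; rewrite /pauli_bond; case: (boolP (odd n)) => on.
  have -> : (n == 0)%N = false by lia.
  apply: scommC; rewrite -[false]/(false (+) false).
  by apply: scommM; exact: Zm_scomm.
have := Zm_Xm_scomm (inord n./2) (inord 0); rewrite inord_eq; [|lia..].
by have -> : (n./2 == 0)%N = (n == 0)%N by lia.
Qed.

Lemma edge_pauli_closing : scomm false (Zm (inord 0)) (pauli_bond (L.*2).-1).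
Proof.
rewrite /pauli_bond; have -> : odd (L.*2).-1 = true by lia.
apply: scommC; rewrite -[false]/(false (+) false).
by apply: scommM; exact: Zm_scomm.
Qed.

Definition pauli_algebra : bond_algebra K N L.*2 :=
  BondAlgebra pauli_bond_sqr pauli_bond_adj pauli_bond_scomm pauli_bond_closing
    (Zm_sqr _) (Zm_adj _) edge_pauli_bond edge_pauli_closing.

Definition zero_config : config L := [ffun=> ord0].
Definition zero_state : 'cV[K]_N := delta_mx (enum_rank zero_config) 0.

Lemma Zm_zero j : Zm j *m zero_state = zero_state.
Proof.
by rewrite (@mono_delta _ _ _ _ _ zero_config) // /zsign ffunE expr0 scale1r.
Qed.

Lemma zero_stab n : odd n -> (n.+1 < L.*2)%N ->
  bond pauli_algebra n *m zero_state = zero_state.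
Proof. by move=> on _; rewrite /= /pauli_bond on -mulmxA !Zm_zero. Qed.

Lemma zero_norm : ev zero_state 1%:M = 1.
Proof.
rewrite /ev mulmx1 !mxE (bigD1 (enum_rank zero_config)) //= big1.
  by rewrite !mxE !eqxx /= rmorph1 mulr1 addr0.
by move=> r rz; rewrite !mxE (negPf rz) /= mulr0.
Qed.

(** * Translation invariance *)

Definition rotate u : config L := [ffun i => u (ordS i)].
Definition unrotate u : config L := [ffun i => u (ord_pred i)].

Lemma rotateK : cancel rotate unrotate.
Proof. by move=> u; apply/ffunP => i; rewrite !ffunE ord_predK. Qed.

Lemma unrotateK : cancel unrotate rotate.
Proof. by move=> u; apply/ffunP => i; rewrite !ffunE ordSK. Qed.

Definition Tm : 'M[K]_N := mono rotate (fun=> 1).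

Lemma Tm_unitary : adj Tm *m Tm = 1%:M.
Proof.
rewrite (mono_adj _ rotateK unrotateK) mono_mul -mono1.
by apply: eq_mono => u /=; rewrite ?unrotateK// rmorph1 mulr1.
Qed.

Lemma Tm_Zm j : Tm *m Zm j = Zm (ordS j) *m Tm.
Proof.
rewrite !mono_mul; apply: eq_mono => u //=.
by rewrite mul1r mulr1 /zsign ffunE.
Qed.

Lemma Tm_Xm j : Tm *m Xm j = Xm (ordS j) *m Tm.
Proof.
rewrite !mono_mul; apply: eq_mono => u //=.
apply/ffunP => i; rewrite !ffunE.
by rewrite (can_eq (@ordSK _)).
Qed.

Lemma Tm_zero : Tm *m zero_state = zero_state.
Proof.
rewrite (@mono_delta _ _ _ _ _ zero_config); first by rewrite scale1r.
have z : unrotate zero_config = zero_config by apply/ffunP => i; rewrite !ffunE.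
move=> u; apply/eqP/eqP => [/(congr1 unrotate)|->].
  by rewrite rotateK z.
by rewrite -[in LHS]z unrotateK.
Qed.

Lemma pauli_bond_XE (j : 'I_L) : pauli_bond (j.*2 + false) = Xm j.
Proof.
rewrite /pauli_bond addn0 odd_double doubleK; congr Xm.
exact: inord_val.
Qed.

Lemma pauli_bond_ZZE (j : 'I_L) :
  pauli_bond (j.*2 + true) = Zm j *m Zm (ordS j).
Proof.
rewrite /pauli_bond addn1 /= odd_double uphalf_double inord_val; congr (_ *m Zm _).
apply/val_inj => /=; have := ltn_ord j; rewrite leq_eqVlt => /orP[/eqP e|lt].
  by rewrite e inord_out modnn.
by rewrite inordK// modn_small.
Qed.

(** A ZZ layer includes the closing bond, so the shift merely permutes its terms cyclically. *)
Lemma Tm_layer e : Tm *m layer pauli_algebra e = layer pauli_algebra e *m Tm.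
Proof.
rewrite /layer mulmx_sumr mulmx_suml [RHS](reindex (@ordS L)) /=; last first.
  by exists (@ord_pred L) => i _; rewrite ?ordSK ?ord_predK.
apply: eq_bigr => j _; case: e.
  by rewrite (pauli_bond_ZZE j) (pauli_bond_ZZE (ordS j)) mulmxA Tm_Zm -mulmxA Tm_Zm mulmxA.
by rewrite (pauli_bond_XE j) (pauli_bond_XE (ordS j)) Tm_Xm.
Qed.

Section Evolution.
Variables (T : zmodType) (ph : phases K T) (t : nat -> T).
Local Notation st := (states ph pauli_algebra zero_state t).

Lemma Tm_states s : Tm *m st s = st s.
Proof.
elim: s => [|s IH] /=; first exact: Tm_zero.
have rA := layer_resolvable ph pauli_algebra L_gt1 (odd s) (t s).
rewrite mulmxA (expmx_intertwine rA rA) -?mulmxA ?IH//.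
by rewrite -scalemxAr -scalemxAl Tm_layer.
Qed.

Lemma ev_rotate s A B : Tm *m A = B *m Tm -> ev (st s) B = ev (st s) A.
Proof.
move=> TA; rewrite -{1}(Tm_states s).
by apply: ev_unitary; [exact: Tm_unitary|rewrite TA].
Qed.

End Evolution.
End Pauli.

(** * The recursion on the Riemann sphere *)

Section ModeAlgebra.
Variable K : numClosedFieldType.
Implicit Types a b e z x y u v : K.

Lemma ratio1_hom u v : v != 0 -> u * Num.conj u + v * Num.conj v = 4 ->
  (u / v) / (1 + `|u / v| ^+ 2) = u * Num.conj v / 4.
Proof.
move=> v0 <-; rewrite normCK rmorphM fmorphV /=.
have cv0 : Num.conj v != 0 by rewrite conjC_eq0.
have s0 : u * Num.conj u + v * Num.conj v != 0.
  rewrite gt_eqF// -!normCK ltr_wpDl// ?exprn_ge0// exprn_gt0// normr_gt0//.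
by field; rewrite v0 cv0 s0.
Qed.

Lemma ratio2_hom u v : v != 0 -> u * Num.conj u + v * Num.conj v = 4 ->
  `|u / v| ^+ 2 / (1 + `|u / v| ^+ 2) = u * Num.conj u / 4.
Proof.
move=> v0 <-; rewrite normCK rmorphM fmorphV /=.
have cv0 : Num.conj v != 0 by rewrite conjC_eq0.
have s0 : u * Num.conj u + v * Num.conj v != 0.
  rewrite gt_eqF// -!normCK ltr_wpDl// ?exprn_ge0// exprn_gt0// normr_gt0//.
by field; rewrite v0 cv0 s0.
Qed.

End ModeAlgebra.

Section Riemann.
Variable R : realType.
Local Notation C := R[i].

(* Homogeneous coordinates [u : v] of z, normalised to |u|^2 + |v|^2 = 4; the
   point at infinity is v = 0. *)
Definition rep (z : sphere R) (u v : C) :=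
  u * Num.conj u + v * Num.conj v = 4 /\
  z = if v == 0 then None else Some (u / v).

Lemma ratio1_rep z u v : rep z u v -> ratio1 z = u * Num.conj v / 4.
Proof.
case=> uv ->; have [->|v0] := eqVneq v 0; first by rewrite rmorph0 mulr0 mul0r.
exact: ratio1_hom.
Qed.

Lemma ratio2_rep z u v : rep z u v -> ratio2 z = u * Num.conj u / 4.
Proof.
case=> uv ->; have [v0|v0] := eqVneq v 0; last exact: ratio2_hom.
move: uv; rewrite v0 mul0r addr0 /= => ->.
by rewrite divff// pnatr_eq0.
Qed.

(** A Moebius map is linear in homogeneous coordinates; the scalar w restores the normalisation of
    the image. *)
Lemma rep_mobius (a b c d w : C) z u v u' v' : rep z u v ->
  a * u + b * v = w * u' -> c * u + d * v = w * v' -> w != 0 ->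
  u' * Num.conj u' + v' * Num.conj v' = 4 ->
  rep (mobius a b c d z) u' v'.
Proof.
case=> uv -> au cu w0 u'v'; split => //; have [v0|v0] := eqVneq v 0.
  move: au cu; rewrite v0 !mulr0 !addr0 => au cu /=.
  have u0 : u != 0.
    apply/eqP => u0; move: uv => /eqP; rewrite u0 v0 !mul0r addr0 eq_sym.
    by rewrite pnatr_eq0.
  have -> : (c == 0) = (v' == 0).
    by rewrite -[c == 0]orbF -(negPf u0) -mulf_eq0 cu mulf_eq0 (negPf w0).
  case: eqP => // /eqP v'0; congr Some.
  have c0 : c != 0.
    apply/eqP => c0; move: cu => /eqP; rewrite c0 mul0r eq_sym mulf_eq0.
    by rewrite (negPf w0) (negPf v'0).
  apply/eqP; rewrite eqr_div//.
  have h : (a * v') * (w * u) = (u' * c) * (w * u).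
    transitivity ((a * u) * (w * v')); first by ring.
    by rewrite au -cu; ring.
  by apply/eqP; apply: (mulIf _ h); rewrite mulf_neq0.
rewrite /=; have e1 : c * (u / v) + d = w * v' / v by rewrite -cu; field.
have e2 : a * (u / v) + b = w * u' / v by rewrite -au; field.
rewrite e1 e2 !mulf_eq0 invr_eq0 (negPf w0) (negPf v0) orbF /=.
case: eqP => // /eqP v'0; congr Some.
by field; rewrite v0 v'0 w0.
Qed.

End Riemann.

(** * One step of the recursion in homogeneous coordinates *)

Section StepAlgebra.
Variables (K : fieldType) (I : K).
Hypothesis I2 : I * I = -1.
Implicit Types X Y z tau E C S : K.

(** Here z stands for e^{-ik}, tau for i tan(k/2), X and Y for the conjugate mode. The Moebius step
    without its phase carries the coordinates used after an even number of half-layers to those used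
    after an odd number, up to a common factor. *)
Lemma even_to_odd z tau X Y : tau * (1 + z) = 1 - z -> 1 + z != 0 ->
  - tau * (Y - I * z * X) + (Y + I * z * X) =
    (- (2 * I * z) / (1 + z)) * - (X - I * Y) /\
  (Y - I * z * X) + - tau * (Y + I * z * X) =
    (- (2 * I * z) / (1 + z)) * (X + I * Y).
Proof.
move=> tz z1; have -> : tau = (1 - z) / (1 + z) by rewrite -tz mulfK.
split.
  transitivity ((2 * I * z * X - 2 * (I * I) * z * Y) / (1 + z)); last by field.
  by rewrite I2; field.
transitivity ((- 2 * I * z * X - 2 * (I * I) * z * Y) / (1 + z)); last by field.
by rewrite I2; field.
Qed.

Lemma odd_to_even z tau X Y : tau * (1 + z) = 1 - z -> 1 + z != 0 ->
  tau * - (X - I * Y) + (X + I * Y) = ((2 * I) / (1 + z)) * (Y - I * z * X) /\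
  - (X - I * Y) + tau * (X + I * Y) = ((2 * I) / (1 + z)) * (Y + I * z * X).
Proof.
move=> tz z1; have -> : tau = (1 - z) / (1 + z) by rewrite -tz mulfK.
split.
  transitivity ((2 * I * Y - 2 * (I * I) * z * X) / (1 + z)); last by field.
  by rewrite I2; field.
transitivity ((2 * I * Y + 2 * (I * I) * z * X) / (1 + z)); last by field.
by rewrite I2; field.
Qed.

(** These coordinates diagonalise the rotation of an X layer. With E = e^{-2i gamma} and E' its
    inverse, their ratio picks up e^{-4i gamma}. *)
Lemma odd_phase C S E E' X Y : C - I * S = E -> C + I * S = E' ->
  - ((C * X - S * Y) - I * (C * Y + S * X)) = E * - (X - I * Y) /\
  (C * X - S * Y) + I * (C * Y + S * X) = E' * (X + I * Y).
Proof.
move=> <- <-; split.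
  transitivity (- C * X + S * (- (I * I)) * Y + I * C * Y + I * S * X); last by ring.
  by rewrite I2; ring.
transitivity (C * X + S * (I * I) * Y + I * C * Y + I * S * X); last by ring.
by rewrite I2; ring.
Qed.

(* Here W stands for z * X. *)
Lemma even_phase C S E E' W Y : C - I * S = E -> C + I * S = E' ->
  (C * Y - S * W) - I * (C * W + S * Y) = E * (Y - I * W) /\
  (C * Y - S * W) + I * (C * W + S * Y) = E' * (Y + I * W).
Proof.
move=> <- <-; split.
  transitivity (C * Y + S * (I * I) * W - I * C * W - I * S * Y); last by ring.
  by rewrite I2; ring.
transitivity (C * Y + S * (I * I) * W + I * C * W + I * S * Y); last by ring.
by rewrite I2; ring.
Qed.

End StepAlgebra.

Section NormAlgebra.
Variables (K : numClosedFieldType) (I : K).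
Hypothesis I2 : I * I = -1.
Hypothesis I_conj : Num.conj I = - I.
Implicit Types x y z : K.
Local Notation "x ^*" := (Num.conj x).

Lemma even_norm x y z : z * z^* = 1 -> x * x^* + y * y^* = 2 ->
  (y^* - I * z * x^*) * (y^* - I * z * x^*)^* +
  (y^* + I * z * x^*) * (y^* + I * z * x^*)^* = 4.
Proof.
move=> zz xy; rewrite !(rmorphB, rmorphD) !rmorphM /= !conjCK I_conj.
transitivity (2 * (y * y^*) + 2 * (- (I * I)) * (z * z^*) * (x * x^*)).
  by ring.
rewrite zz I2 opprK; transitivity (2 * (x * x^* + y * y^*)); first by ring.
by rewrite xy -natrM.
Qed.

Lemma odd_norm x y : x * x^* + y * y^* = 2 ->
  - (x^* - I * y^*) * (- (x^* - I * y^*))^* +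
  (x^* + I * y^*) * (x^* + I * y^*)^* = 4.
Proof.
move=> xy; rewrite rmorphN !(rmorphB, rmorphD) !rmorphM /= !conjCK I_conj.
transitivity (2 * (x * x^*) + 2 * (- (I * I)) * (y * y^*)); first by ring.
rewrite I2 opprK; transitivity (2 * (x * x^* + y * y^*)); first by ring.
by rewrite xy -natrM.
Qed.

Lemma even_update (c d w w' e e' x y : K) : c^* = c -> d^* = d ->
  w^* = w' -> w'^* = w -> w * w' = 1 -> c - I * d = e -> c + I * d = e' ->
  (c * y - d * w * x)^* - I * w' * (c * x + d * w' * y)^* =
    e * (y^* - I * w' * x^*) /\
  (c * y - d * w * x)^* + I * w' * (c * x + d * w' * y)^* =
    e' * (y^* + I * w' * x^*).
Proof.
move=> cc dc wc w'c ww ce ce'.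
have [h1 h2] := even_phase I2 (w' * x^*) (y^*) ce ce'.
rewrite !(rmorphB, rmorphD) !rmorphM /= cc dc wc w'c; split.
  rewrite -[in RHS]mulrA -h1.
  transitivity (c * y^* - d * (w' * x^*) -
    I * (c * (w' * x^*) + d * (w * w') * y^*)); first by ring.
  by rewrite ww; ring.
rewrite -[in RHS]mulrA -h2.
transitivity (c * y^* - d * (w' * x^*) +
    I * (c * (w' * x^*) + d * (w * w') * y^*)); first by ring.
by rewrite ww; ring.
Qed.

Lemma odd_update (c d e e' x y : K) : c^* = c -> d^* = d ->
  c - I * d = e -> c + I * d = e' ->
  - ((c * x - d * y)^* - I * (c * y + d * x)^*) = e * - (x^* - I * y^*) /\
  (c * x - d * y)^* + I * (c * y + d * x)^* = e' * (x^* + I * y^*).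
Proof.
move=> cc dc ce ce'; rewrite !(rmorphB, rmorphD) !rmorphM /= cc dc.
exact: odd_phase.
Qed.

End NormAlgebra.

Section Modes.
Variable R : realType.
Local Notation C := R[i].
Local Notation "''I'" := ('i%C : C).
Implicit Types k t : R.

Lemma i_sqr : 'I * 'I = -1. Proof. by rewrite -expr2 sqr_i. Qed.

Lemma i_conj : Num.conj 'I = - 'I.
Proof. by rewrite -[LHS]/('i^*)%C; simpc. Qed.

Lemma conj_expiE t : Num.conj (expi t) = expi (- t).
Proof. exact: conj_expi. Qed.

Lemma conj_real (a : R) : Num.conj (a%:C : C) = a%:C.
Proof. exact: conjc_real. Qed.

Definition complex_phases : phases C R :=
  @Phases C R 'I (fun x => x%:C) (@expi R) i_sqr i_conj
    (fun s t => rmorphD _ s t) (@expiD R) (expi0 R) conj_expiE (@cvg_expi R).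

Lemma i_neq0 : 'I != 0. Proof. exact: (phI_neq0 complex_phases). Qed.

Lemma phcosE t : phcos complex_phases t = (cos t)%:C.
Proof.
rewrite /phcos /= !expiE cosN sinN rmorphN /=.
by move: (cos t)%:C (sin t)%:C => c s; field.
Qed.

Lemma phsinE t : phsin complex_phases t = (sin t)%:C.
Proof.
rewrite /phsin /= !expiE cosN sinN rmorphN /=.
by move: (cos t)%:C (sin t)%:C => c s; field; rewrite i_neq0.
Qed.

(** Factoring e^{-ik/2} out of 1 + e^{-ik} and 1 - e^{-ik} leaves 2 cos(k/2) and 2 i sin(k/2); the
    open interval keeps the cosine nonzero. *)
Lemma itan_expi k : k \in `]-pi, pi[ ->
  itan k * (1 + expi (- k)) = 1 - expi (- k) /\ 1 + expi (- k) != 0.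
Proof.
rewrite in_itv /= => /andP[k1 k2].
have c0 : cos (k / 2) != 0 by rewrite gt_eqF// cos_gt0_pihalf//; apply/andP; lra.
have ke : - k = - (k / 2) + - (k / 2) by field.
have n2 : (2 : C) != 0 by rewrite pnatr_eq0.
have zE : 1 + expi (- k) = 2 * (cos (k / 2))%:C * expi (- (k / 2)).
  rewrite ke expiD -{1}(expiNK (k / 2)) -mulrDl; congr (_ * _).
  by rewrite !expiE cosN sinN rmorphN /=; ring.
have zE' : 1 - expi (- k) = 2 * ('I * (sin (k / 2))%:C) * expi (- (k / 2)).
  rewrite ke expiD -{1}(expiNK (k / 2)) -mulrBl; congr (_ * _).
  by rewrite !expiE cosN sinN rmorphN /=; ring.
have cc0 : (cos (k / 2))%:C != 0 :> C by rewrite fmorph_eq0.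
rewrite zE zE' /itan /tan fmorph_div /=; split.
  move: (sin (k / 2))%:C (cos (k / 2))%:C cc0 (expi _) => s c' c'0 e.
  by field.
rewrite !mulf_neq0//; apply/eqP => e0; have := expiNK (- (k / 2)).
by move=> /eqP; rewrite e0 mul0r eq_sym oner_eq0.
Qed.

Variables gamma beta : nat -> R.

Definition angle s : R := if odd s then beta s./2.+1 else gamma s./2.+1.

Definition ccos s : C := (cos (angle s + angle s))%:C.
Definition csin s : C := (sin (angle s + angle s))%:C.

(* The modes after s half-layers are phi_{2j} = e^{ikj} (chi s k).1 and
   phi_{2j+1} = e^{ikj} (chi s k).2. *)
Fixpoint chi s k : C * C :=
  if s is r.+1 then
    let: (x, y) := chi r k in
    if odd r then (ccos r * x + csin r * expi (- k) * y,
                   ccos r * y - csin r * expi k * x)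
    else (ccos r * x - csin r * y, ccos r * y + csin r * x)
  else (1, - 'I * expi k).

Lemma csin_ccos s : ccos s * ccos s + csin s * csin s = 1.
Proof. by rewrite -!rmorphM -rmorphD -!expr2 cos2Dsin2. Qed.

Lemma chi_norm s k :
  (chi s k).1 * Num.conj (chi s k).1 + (chi s k).2 * Num.conj (chi s k).2 = 2.
Proof.
elim: s => [|s] /=.
  rewrite rmorph1 rmorphM rmorphN /= i_conj conj_expiE opprK mulr1.
  have -> : - 'I * expi k * ('I * expi (- k)) = - ('I * 'I) * (expi k * expi (- k)).
    by ring.
  by rewrite i_sqr expiNK opprK mulr1.
case: (chi s k) => x y /= <-.
have cs := csin_ccos s; have ee := expiNK k.
case: (odd s) => /=.
  rewrite !(rmorphB, rmorphD) !rmorphM /= !conj_real !conj_expiE opprK.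
  transitivity (ccos s * ccos s * (x * Num.conj x + y * Num.conj y) +
    (csin s * csin s) * (expi k * expi (- k)) * (x * Num.conj x + y * Num.conj y)).
    by ring.
  by rewrite ee mulr1 -mulrDl cs mul1r.
rewrite !(rmorphB, rmorphD) !rmorphM /= !conj_real.
transitivity ((ccos s * ccos s + csin s * csin s) *
   (x * Num.conj x + y * Num.conj y)); first by ring.
by rewrite cs mul1r.
Qed.

(** Components of the conjugate mode in the eigenbasis of the ZZ rotation ([even_u], [even_v]) and
    of the X rotation ([odd_u], [odd_v]). *)
Definition even_u k (p : C * C) := Num.conj p.2 - 'I * expi (- k) * Num.conj p.1.
Definition even_v k (p : C * C) := Num.conj p.2 + 'I * expi (- k) * Num.conj p.1.
Definition odd_u (p : C * C) := - (Num.conj p.1 - 'I * Num.conj p.2).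
Definition odd_v (p : C * C) := Num.conj p.1 + 'I * Num.conj p.2.

Lemma even_norm_chi s k : even_u k (chi s k) * Num.conj (even_u k (chi s k)) +
  even_v k (chi s k) * Num.conj (even_v k (chi s k)) = 4.
Proof.
apply: even_norm; [exact: i_sqr|exact: i_conj| |exact: chi_norm].
by rewrite conj_expiE opprK mulrC expiNK.
Qed.

Lemma odd_norm_chi s k : odd_u (chi s k) * Num.conj (odd_u (chi s k)) +
  odd_v (chi s k) * Num.conj (odd_v (chi s k)) = 4.
Proof. apply: odd_norm; [exact: i_sqr|exact: i_conj|exact: chi_norm]. Qed.

Lemma ccosB s : ccos s - 'I * csin s = expi (- (2 * angle s)).
Proof.
by rewrite expiE cosN sinN rmorphN /= mulrN mulr_natl mulr2n.
Qed.

Lemma ccosD s : ccos s + 'I * csin s = expi (2 * angle s).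
Proof. by rewrite expiE mulr_natl mulr2n. Qed.

Lemma expi_neq0 t : expi t != 0.
Proof.
apply/eqP => e0; have := expiNK t; rewrite e0 mul0r => /eqP.
by rewrite eq_sym oner_eq0.
Qed.

Lemma rep_f s k : k \in `]-pi, pi[ ->
  if odd s then rep (f_ gamma beta s k) (odd_u (chi s k)) (odd_v (chi s k))
  else rep (f_ gamma beta s k) (even_u k (chi s k)) (even_v k (chi s k)).
Proof.
move=> kpi; have [tz z1] := itan_expi kpi.
have n2 : (2 : C) != 0 by rewrite pnatr_eq0.
elim: s => [|s IH].
  (* The conjugate of the initial mode is (1, i e^{-ik}), so u = 0 and v = 2 i e^{-ik}, which
     represents f_0 = 0. *)
  split; first exact: even_norm_chi.
  rewrite /even_u /even_v /= rmorph1 rmorphM rmorphN /= i_conj conj_expiE opprK mulr1.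
  rewrite subrr mul0r ifF//; apply/negbTE.
  by rewrite -mulr2n -mulr_natr !mulf_neq0 ?i_neq0 ?expi_neq0.
have e4 : expi (- (4 * angle s)) = expi (- (2 * angle s)) * expi (- (2 * angle s)).
  by rewrite -expiD; congr expi; ring.
have EE : expi (- (2 * angle s)) * expi (2 * angle s) = 1.
  by rewrite mulrC expiNK.
have cB := ccosB s; have cD := ccosD s.
have nE := even_norm_chi s.+1 k; have nO := odd_norm_chi s.+1 k.
rewrite /=; move: IH nE nO; rewrite /= /angle in e4 EE cB cD *.
case: (chi s k) => x y; case: (odd s) in e4 EE cB cD *.
  rewrite e4 /=; move: (expi (- (2 * _))) (expi (2 * _)) EE cB cD.
  move=> E E' EE cB cD IH nE _.
  have [h1 h2] := odd_to_even i_sqr (Num.conj x) (Num.conj y) tz z1.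
  have [u'E v'E] := even_update i_sqr x y (conj_real _ : Num.conj (ccos s) = _)
    (conj_real _ : Num.conj (csin s) = _) (conj_expiE k)
    (etrans (conj_expiE (- k)) (congr1 (@expi R) (opprK k))) (expiNK k) cB cD.
  (* The step has phase E * E, and the layer multiplies the coordinates by E and E' = 1/E. Hence
     both lines share one factor E besides the scalar of [odd_to_even]. *)
  apply: (rep_mobius (w := E * (2 * 'I / (1 + expi (- k)))) IH) => //.
  - transitivity (E * E * (itan k * odd_u (x, y) + odd_v (x, y))); first by ring.
    by rewrite [X in E * E * X]h1 [X in _ = _ * X]u'E; ring.
  - rewrite mul1r [LHS]h2 [X in _ = _ * X]v'E.
    rewrite [RHS](_ : _ = (E * E') * (2 * 'I / (1 + expi (- k)) *
      (Num.conj y + 'I * expi (- k) * Num.conj x))); first by rewrite EE mul1r.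
    by ring.
  - rewrite !mulf_neq0 ?invr_eq0 ?i_neq0//.
    by apply/eqP => E0; move: EE => /eqP; rewrite E0 mul0r eq_sym oner_eq0.
rewrite e4 /=; move: (expi (- (2 * _))) (expi (2 * _)) EE cB cD.
move=> E E' EE cB cD IH _ nO.
have [h1 h2] := even_to_odd i_sqr (Num.conj x) (Num.conj y) tz z1.
have [u'E v'E] := odd_update i_sqr x y (conj_real _ : Num.conj (ccos s) = _)
  (conj_real _ : Num.conj (csin s) = _) cB cD.
apply: (rep_mobius (w := E * (- (2 * 'I * expi (- k)) / (1 + expi (- k)))) IH) => //.
- transitivity (E * E * (- itan k * even_u k (x, y) + even_v k (x, y))).
    by ring.
  by rewrite [X in E * E * X]h1 [X in _ = _ * X]u'E; ring.
- rewrite mul1r [LHS]h2 [X in _ = _ * X]v'E.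
  rewrite [RHS](_ : _ = (E * E') * (- (2 * 'I * expi (- k)) / (1 + expi (- k)) *
      (Num.conj x + 'I * Num.conj y))); first by rewrite EE mul1r.
  by ring.
- rewrite !mulf_neq0 ?invr_eq0 ?oppr_eq0 ?mulf_neq0 ?i_neq0 ?expi_neq0//.
  by apply/eqP => E0; move: EE => /eqP; rewrite E0 mul0r eq_sym oner_eq0.
Qed.

(** The map defining [g_] is an X step of angle 0: it changes the coordinates and leaves the mode
    alone. *)
Lemma rep_g p k : k \in `]-pi, pi[ ->
  rep (g_ gamma beta p k) (odd_u (chi p.*2 k)) (odd_v (chi p.*2 k)).
Proof.
move=> kpi; have [tz z1] := itan_expi kpi.
have n2 : (2 : C) != 0 by rewrite pnatr_eq0.
have := rep_f p.*2 kpi; rewrite odd_double => IH.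
have [h1 h2] := even_to_odd i_sqr (Num.conj (chi p.*2 k).1)
  (Num.conj (chi p.*2 k).2) tz z1.
apply: (rep_mobius (w := - (2 * 'I * expi (- k)) / (1 + expi (- k))) IH).
- by rewrite mul1r; exact: h1.
- by rewrite mul1r; exact: h2.
- by rewrite !mulf_neq0 ?invr_eq0 ?oppr_eq0 ?mulf_neq0 ?i_neq0 ?expi_neq0.
exact: odd_norm_chi.
Qed.

End Modes.

(** * Fourier integrals of the modes *)

Section PuncturedIntegral.
Variable R : realType.
Implicit Types (f F : R -> R) (a x : R).
Local Notation mu := (@lebesgue_measure R).
Local Notation D := (`]-pi, pi[ `\ 0 : set R).

Lemma measurable_D : measurable D.
Proof. by apply: measurableD. Qed.

Lemma sub_D : D `<=` `[-pi, pi].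
Proof. by move=> x [/=]; rewrite !in_itv /= => /andP[/ltW -> /ltW ->]. Qed.

Lemma continuous_integrable_D f : continuous f -> mu.-integrable D (EFin \o f).
Proof.
move=> cf; apply: (@integrableS _ _ _ mu `[-pi, pi]%classic) => //.
- exact: measurable_D.
- exact: sub_D.
apply: continuous_compact_integrable; first exact: segment_compact.
exact: continuous_subspaceT.
Qed.

Lemma Rintegral_D f : continuous f ->
  \int[mu]_(x in D) f x = \int[mu]_(x in `[-pi, pi]) f x.
Proof.
move=> cf; have mf : measurable_fun setT f by exact: continuous_measurable_fun.
have mE (A : set R) : measurable_fun A (EFin \o f).
  by apply/measurable_EFinP; apply: measurable_funTS.
rewrite /Rintegral integral_setD1; [|exact: measurable_D|exact: mE].
by rewrite -integral_itv_obnd_cbnd ?integral_itv_bndo_bndc//; exact: mE.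
Qed.

Lemma Rintegral_D_derive F f : (forall x, is_derive x 1 F (f x)) ->
  continuous f -> \int[mu]_(x in D) f x = F pi - F (- pi).
Proof.
move=> dF cf; have p0 := pi_gt0 R.
have cF : continuous F.
  by move=> x; apply/differentiable_continuous/derivable1_diffP; case: (dF x).
rewrite Rintegral_D// /Rintegral (@continuous_FTC2 _ f F)//.
- by lra.
- exact: continuous_subspaceT.
- split => [x _||]; first by case: (dF x).
  + by apply: cvg_at_right_filter; exact: cF.
  + by apply: cvg_at_left_filter; exact: cF.
- by move=> x _; rewrite derive1E; case: (dF x).
Qed.

Lemma continuous_cosM a : continuous (fun x => cos (x * a)).
Proof.
move=> x; apply: continuous_comp; last exact: continuous_cos.
exact: mulrr_continuous.
Qed.

Lemma continuous_sinM a : continuous (fun x => sin (x * a)).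
Proof.
move=> x; apply: continuous_comp; last exact: continuous_sin.
exact: mulrr_continuous.
Qed.

Lemma is_derive_mulr a x : is_derive x 1 (fun y : R => y * a) a.
Proof.
rewrite (_ : (fun y => _) = (a \*: (@id R))); last first.
  by apply/funext => y; rewrite mulrC.
by apply: is_derive_eq; rewrite /GRing.scale /= mulr1.
Qed.

(** The antiderivative is even, so its values at pi and - pi cancel for every real frequency. *)
Lemma int_sinM a : \int[mu]_(x in D) sin (x * a) = 0.
Proof.
have [->|a0] := eqVneq a 0.
  rewrite (_ : (fun x : R => sin (x * 0)) = cst 0); last first.
    by apply/funext => x; rewrite mulr0 sin0.
  by rewrite Rintegral_cst ?mul0r//; exact: measurable_D.
have dF x : is_derive x 1 (fun x => - a^-1 * cos (x * a)) (sin (x * a)).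
  have h := is_derive_mulr a x.
  have h2 := @is_derive1_comp R cos (fun y => y * a) x _ _ (is_derive_cos _) h.
  have h3 := @is_deriveZ R R R _ (- a^-1) x 1 _ h2.
  apply: is_derive_eq h3 _.
  by rewrite /GRing.scale /=; field.
rewrite (Rintegral_D_derive dF) ?mulNr ?cosN ?subrr//.
exact: continuous_sinM.
Qed.

Lemma sin_npi n : sin (pi * n%:R) = 0 :> R.
Proof.
elim: n => [|n IH]; first by rewrite mulr0 sin0.
by rewrite -natr1 mulrDr mulr1 sinDpi IH oppr0.
Qed.

Lemma int_cosM n m :
  \int[mu]_(x in D) cos (x * (n%:R - m%:R)) = (pi *+ 2) * (n == m)%:R.
Proof.
have [->|nm] := eqVneq n m.
  have dF (x : R) : is_derive x 1 id (cos (x * 0)).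
    by rewrite mulr0 cos0; exact: is_derive_id.
  rewrite subrr (Rintegral_D_derive dF); last exact: continuous_cosM.
  by rewrite opprK mulr1.
set a : R := n%:R - m%:R; have a0 : a != 0.
  by rewrite subr_eq0 eqr_nat.
have sa : sin (pi * a) = 0.
  by rewrite mulrBr sinB !sin_npi mul0r mulr0 subrr.
have dF x : is_derive x 1 (fun x => a^-1 * sin (x * a)) (cos (x * a)).
  have h := is_derive_mulr a x.
  have h2 := @is_derive1_comp R sin (fun y => y * a) x _ _ (is_derive_sin _) h.
  have h3 := @is_deriveZ R R R _ a^-1 x 1 _ h2.
  apply: is_derive_eq h3 _.
  by rewrite /GRing.scale /=; field.
rewrite (Rintegral_D_derive dF); last exact: continuous_cosM.
by rewrite mulNr sinN sa oppr0 subrr mulr0.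
Qed.

End PuncturedIntegral.

(** * Integrals and means of complex-valued functions *)

Section ComplexIntegral.
Variable R : realType.
Local Notation C := R[i].
Local Notation D := (`]-pi, pi[ `\ 0 : set R).
Local Notation Re := complex.Re.
Local Notation Im := complex.Im.
Implicit Types (f g h : R -> C) (a : C).

Lemma Re_mul (a b : C) : Re (a * b) = Re a * Re b - Im a * Im b.
Proof. by case: a b => [? ?] [? ?]. Qed.

Lemma Im_mul (a b : C) : Im (a * b) = Re a * Im b + Im a * Re b.
Proof. by case: a b => [? ?] [? ?]. Qed.

Lemma Re_add (a b : C) : Re (a + b) = Re a + Re b.
Proof. by case: a b => [? ?] [? ?]. Qed.

Lemma Im_add (a b : C) : Im (a + b) = Im a + Im b.
Proof. by case: a b => [? ?] [? ?]. Qed.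

Lemma Re_conj (a : C) : Re (Num.conj a) = Re a.
Proof. by rewrite -[Num.conj a]/(conjc a); case: a. Qed.

Lemma Im_conj (a : C) : Im (Num.conj a) = - Im a.
Proof. by rewrite -[Num.conj a]/(conjc a); case: a. Qed.

(** Real and imaginary parts are kept apart because [integral_pi] integrates them separately. *)
Definition ccont h := continuous (fun k => Re (h k)) /\ continuous (fun k => Im (h k)).

Lemma ccontD f g : ccont f -> ccont g -> ccont (fun k => f k + g k).
Proof.
move=> [f1 f2] [g1 g2]; split=> k.
  rewrite (_ : (fun _ => _) = (fun k => Re (f k) + Re (g k))).
    by apply: continuousD; [exact: f1|exact: g1].
  by apply/funext => x; rewrite Re_add.
rewrite (_ : (fun _ => _) = (fun k => Im (f k) + Im (g k))).
  by apply: continuousD; [exact: f2|exact: g2].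
by apply/funext => x; rewrite Im_add.
Qed.

Lemma continuous_mulr (u v : R -> R) : continuous u -> continuous v ->
  continuous (fun k => u k * v k).
Proof. by move=> cu cv k; apply: continuousM; [exact: cu|exact: cv]. Qed.

Lemma continuous_addr (u v : R -> R) : continuous u -> continuous v ->
  continuous (fun k => u k + v k).
Proof. by move=> cu cv k; apply: continuousD; [exact: cu|exact: cv]. Qed.

Lemma continuous_oppr (u : R -> R) : continuous u -> continuous (fun k => - u k).
Proof. by move=> cu k; apply: continuousN; exact: cu. Qed.

Lemma ccontM f g : ccont f -> ccont g -> ccont (fun k => f k * g k).
Proof.
move=> [f1 f2] [g1 g2]; split.
  rewrite (_ : (fun _ => _) = (fun k => Re (f k) * Re (g k) + - (Im (f k) * Im (g k)))).
    by apply: continuous_addr; [|apply: continuous_oppr]; exact: continuous_mulr.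
  by apply/funext => x; rewrite Re_mul.
rewrite (_ : (fun _ => _) = (fun k => Re (f k) * Im (g k) + Im (f k) * Re (g k))).
  by apply: continuous_addr; exact: continuous_mulr.
by apply/funext => x; rewrite Im_mul.
Qed.

Lemma ccont_cst a : ccont (fun=> a).
Proof. by split=> k; exact: cvg_cst. Qed.

Lemma ccont_conj f : ccont f -> ccont (fun k => Num.conj (f k)).
Proof.
move=> [f1 f2]; split=> k.
  rewrite (_ : (fun _ => _) = (fun k => Re (f k))); first exact: f1.
  by apply/funext => x; rewrite Re_conj.
rewrite (_ : (fun _ => _) = (fun k => - Im (f k))).
  by apply: continuousN; exact: f2.
by apply/funext => x; rewrite Im_conj.
Qed.

Lemma ccont_expi (r : R) : ccont (fun k => expi (k * r)).
Proof. by split; [exact: continuous_cosM|exact: continuous_sinM]. Qed.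

Lemma eq_integral_pi f g : {in D, f =1 g} -> integral_pi f = integral_pi g.
Proof.
by move=> fg; rewrite /integral_pi; congr (_ +i* _); apply: eq_Rintegral => k kD;
  rewrite fg.
Qed.

Lemma integral_piD f g : ccont f -> ccont g ->
  integral_pi (fun k => f k + g k) = integral_pi f + integral_pi g.
Proof.
move=> [f1 f2] [g1 g2]; rewrite /integral_pi.
have mD := @measurable_D R.
have -> : \int[lebesgue_measure]_(k in D) Re (f k + g k) =
  \int[lebesgue_measure]_(k in D) Re (f k) + \int[lebesgue_measure]_(k in D) Re (g k).
  rewrite -RintegralD//; try exact: continuous_integrable_D.
  by apply: eq_Rintegral => k _; rewrite Re_add.
have -> : \int[lebesgue_measure]_(k in D) Im (f k + g k) =
  \int[lebesgue_measure]_(k in D) Im (f k) + \int[lebesgue_measure]_(k in D) Im (g k).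
  rewrite -RintegralD//; try exact: continuous_integrable_D.
  by apply: eq_Rintegral => k _; rewrite Im_add.
by [].
Qed.

Lemma integral_piZ a f : ccont f ->
  integral_pi (fun k => a * f k) = a * integral_pi f.
Proof.
move=> [f1 f2]; have mD := @measurable_D R.
have if1 := continuous_integrable_D f1; have if2 := continuous_integrable_D f2.
have Z (r : R) (u : R -> R) : continuous u -> continuous (fun k => r * u k).
  by move=> cu k; apply: continuousM; [exact: cvg_cst|exact: cu].
have iZ (r : R) (u : R -> R) : continuous u ->
   lebesgue_measure.-integrable D (EFin \o (fun k => r * u k)).
  by move=> cu; apply: continuous_integrable_D; exact: Z.
rewrite /integral_pi.
have -> : \int[lebesgue_measure]_(k in D) Re (a * f k) =
  Re a * \int[lebesgue_measure]_(k in D) Re (f k) -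
  Im a * \int[lebesgue_measure]_(k in D) Im (f k).
  rewrite -!RintegralZl// -RintegralB//; [|exact: iZ..].
  by apply: eq_Rintegral => k _; rewrite Re_mul.
have -> : \int[lebesgue_measure]_(k in D) Im (a * f k) =
  Re a * \int[lebesgue_measure]_(k in D) Im (f k) +
  Im a * \int[lebesgue_measure]_(k in D) Re (f k).
  rewrite -!RintegralZl// -RintegralD//; [|exact: iZ..].
  by apply: eq_Rintegral => k _; rewrite Im_mul.
by case: a.
Qed.

Definition mean h : C := ((pi *+ 2)^-1)%:C * integral_pi h.

Lemma eq_mean f g : {in D, f =1 g} -> mean f = mean g.
Proof. by move=> fg; rewrite /mean (eq_integral_pi fg). Qed.

Lemma meanD f g : ccont f -> ccont g ->
  mean (fun k => f k + g k) = mean f + mean g.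
Proof. by move=> cf cg; rewrite /mean integral_piD// mulrDr. Qed.

Lemma meanZ a f : ccont f -> mean (fun k => a * f k) = a * mean f.
Proof. by move=> cf; rewrite /mean integral_piZ// mulrCA. Qed.

Lemma mean_lin4 (a b c d : C) (f g h j : R -> C) :
  ccont f -> ccont g -> ccont h -> ccont j ->
  mean (fun k => a * f k + b * g k + c * h k + d * j k) =
  a * mean f + b * mean g + c * mean h + d * mean j.
Proof.
move=> cf cg ch cj.
have cM (e : C) u : ccont u -> ccont (fun k => e * u k).
  exact: (ccontM (ccont_cst e)).
rewrite (meanD (ccontD (ccontD (cM a _ cf) (cM b _ cg)) (cM c _ ch)) (cM d _ cj)).
rewrite (meanD (ccontD (cM a _ cf) (cM b _ cg)) (cM c _ ch)).
rewrite (meanD (cM a _ cf) (cM b _ cg)).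
by rewrite (meanZ a cf) (meanZ b cg) (meanZ c ch) (meanZ d cj).
Qed.

Lemma mean_expi (n m : nat) :
  mean (fun k => expi (k * (n%:R - m%:R))) = (n == m)%:R.
Proof.
have p0 : (pi *+ 2 : R) != 0 by rewrite mulrn_eq0 /= gt_eqF// pi_gt0.
rewrite /mean /integral_pi /= int_cosM int_sinM.
have -> : ((pi *+ 2) * (n == m)%:R +i* 0 : C) = ((pi *+ 2) * (n == m)%:R)%:C by [].
by rewrite -rmorphM mulKf// rmorph_nat.
Qed.

Lemma pi_mean h : ((pi : R)^-1)%:C * integral_pi h = 2 * mean h.
Proof.
rewrite /mean mulrA; congr (_ * _).
have p0 : (pi : R) != 0 by rewrite gt_eqF// pi_gt0.
have -> : (2 : C) = (2 : R)%:C by rewrite rmorph_nat.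
rewrite -rmorphM; congr (_%:C).
by rewrite -[pi *+ 2]mulr_natl invfM mulrA divff ?mul1r// pnatr_eq0.
Qed.

End ComplexIntegral.

(** * Two-point functions as inner products of modes *)

Section Correlations.
Variable R : realType.
Local Notation C := R[i].
Local Notation "''I'" := ('i%C : C).
Variables gamma beta : nat -> R.
Local Notation chi := (chi gamma beta).
Local Notation ccos := (ccos gamma beta).
Local Notation csin := (csin gamma beta).
Local Notation ang := (angle gamma beta).
Local Notation ph := (complex_phases R).

Definition phi s n k : C :=
  expi (k * (n./2)%:R) * (if odd n then (chi s k).2 else (chi s k).1).

Definition corr s n m : C := mean (fun k => phi s n k * Num.conj (phi s m k)).

Lemma ccont_expi1 : ccont (fun k : R => expi k).
Proof.
have := @ccont_expi R 1; rewrite (_ : (fun k => _) = (fun k => expi k))//.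
by apply/funext => k; rewrite mulr1.
Qed.

Lemma ccont_expiN : ccont (fun k : R => expi (- k)).
Proof.
have := @ccont_expi R (-1); rewrite (_ : (fun k => _) = (fun k => expi (- k)))//.
by apply/funext => k; rewrite mulrN1.
Qed.

Lemma ccont_chi s : ccont (fun k => (chi s k).1) /\ ccont (fun k => (chi s k).2).
Proof.
elim: s => [|s [IH1 IH2]].
  split; first exact: ccont_cst.
  by apply: ccontM; [exact: ccont_cst|exact: ccont_expi1].
have h1 k : (chi s.+1 k).1 = if odd s
    then ccos s * (chi s k).1 + csin s * expi (- k) * (chi s k).2
    else ccos s * (chi s k).1 + - csin s * (chi s k).2.
  by rewrite /=; case: (chi s k) => x y; case: (odd s) => //=; rewrite mulNr.
have h2 k : (chi s.+1 k).2 = if odd s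
    then ccos s * (chi s k).2 + - csin s * expi k * (chi s k).1
    else ccos s * (chi s k).2 + csin s * (chi s k).1.
  by rewrite /=; case: (chi s k) => x y; case: (odd s) => //=; rewrite !mulNr.
have cM a f : ccont f -> ccont (fun k : R => a * f k).
  exact: (ccontM (ccont_cst a)).
split; [rewrite (funext h1)|rewrite (funext h2)]; case: (odd s).
- exact: (ccontD (cM _ _ IH1) (ccontM (cM _ _ ccont_expiN) IH2)).
- exact: (ccontD (cM _ _ IH1) (cM _ _ IH2)).
- exact: (ccontD (cM _ _ IH2) (ccontM (cM _ _ ccont_expi1) IH1)).
- exact: (ccontD (cM _ _ IH2) (cM _ _ IH1)).
Qed.

Lemma ccont_phi s n : ccont (phi s n).
Proof.
have [c1 c2] := ccont_chi s; apply: ccontM; first exact: ccont_expi.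
by case: (odd n).
Qed.

Lemma ccont_phi2 s n m : ccont (fun k => phi s n k * Num.conj (phi s m k)).
Proof. by apply: ccontM; [|apply: ccont_conj]; exact: ccont_phi. Qed.

Definition csgn s n : C := if odd n == odd s then - csin s else csin s.

(** The same rotation as [rotmaj]. In a ZZ layer the neighbour lies in the next or previous cell,
    which accounts for the factors e^{ik} and e^{-ik} in [chi]. *)
Lemma phiS s n k : (0 < n)%N ->
  phi s.+1 n k = ccos s * phi s n k + csgn s n * phi s (nbr (odd s) n) k.
Proof.
move=> n0; rewrite /phi /csgn /nbr /=; case: (chi s k) => x y.
case: (boolP (odd s)) => os; case: (boolP (odd n)) => on /=.
- rewrite on /=.
  have -> : uphalf n = n./2.+1 by lia.
  by rewrite -natr1 [k * (_ + 1)]mulrDr [k * 1]mulr1 expiD; ring.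
- have -> : odd n.-1 by lia.
  have e : n./2 = (n.-1)./2.+1 by lia.
  rewrite e -natr1 [k * (_ + 1)]mulrDr [k * 1]mulr1 expiD /=.
  transitivity (ccos s * (expi (k * n.-1./2%:R) * expi k * x) +
    csin s * (expi (k * n.-1./2%:R) * (expi k * expi (- k)) * y)).
    by ring.
  by rewrite expiNK mulr1; ring.
- have -> : odd n.-1 = false by lia.
  have -> : (n.-1)./2 = n./2 by lia.
  by ring.
- rewrite on /=; have -> : uphalf n = n./2 by lia.
  by ring.
Qed.

Lemma ccos_conj s : Num.conj (ccos s) = ccos s.
Proof. exact: conj_real. Qed.

Lemma csgn_conj s n : Num.conj (csgn s n) = csgn s n.
Proof.
by rewrite /csgn; case: ifP => _; rewrite ?rmorphN /= [Num.conj (csin s)]conj_real.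
Qed.

Lemma corrS s n m : (0 < n)%N -> (0 < m)%N -> corr s.+1 n m =
  ccos s * ccos s * corr s n m + ccos s * csgn s m * corr s n (nbr (odd s) m) +
  csgn s n * ccos s * corr s (nbr (odd s) n) m +
  csgn s n * csgn s m * corr s (nbr (odd s) n) (nbr (odd s) m).
Proof.
move=> n0 m0; have cp := ccont_phi2 s.
transitivity (mean (fun k =>
    ccos s * ccos s * (phi s n k * Num.conj (phi s m k)) +
    ccos s * csgn s m * (phi s n k * Num.conj (phi s (nbr (odd s) m) k)) +
    csgn s n * ccos s * (phi s (nbr (odd s) n) k * Num.conj (phi s m k)) +
    csgn s n * csgn s m *
      (phi s (nbr (odd s) n) k * Num.conj (phi s (nbr (odd s) m) k)))); last first.
  exact: mean_lin4.
apply: eq_mean => k _; rewrite !phiS//.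
have cc := ccos_conj s; have cs := csgn_conj s m.
move: (ccos s) (csgn s n) (csgn s m) cc cs => u v w cc cs.
by rewrite rmorphD !rmorphM /= cc cs; ring.
Qed.

Lemma phi0 n k : phi 0 n k = (if odd n then - 'I else 1) * expi (k * (uphalf n)%:R).
Proof.
rewrite /phi; case: (boolP (odd n)) => on /=.
  have -> : uphalf n = n./2.+1 by lia.
  by rewrite -natr1 [k * (_ + 1)]mulrDr [k * 1]mulr1 expiD; ring.
have -> : uphalf n = n./2 by lia.
by rewrite mulr1 mul1r.
Qed.

(** Two positive indices have the same [uphalf] exactly when they are equal or partners, so
    orthogonality of the exponentials leaves the two terms of [pair0]. *)
Lemma corr0 n m : (0 < n)%N -> (0 < m)%N -> corr 0 n m = pair0 ph n m.
Proof.
move=> n0 m0.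
have -> : corr 0 n m = (if odd n then - 'I else 1) *
    Num.conj (if odd m then - 'I else 1) * (uphalf n == uphalf m)%:R.
  rewrite -mean_expi -meanZ; last exact: ccont_expi.
  apply: eq_mean => k _; rewrite !phi0 rmorphM /= conj_expiE mulrBr expiD.
  by ring.
rewrite /pair0 /kap /partner /=.
case: (boolP (odd n)) => on; case: (boolP (odd m)) => om.
- rewrite rmorphN /= i_conj opprK mulNr i_sqr opprK mul1r.
  have -> : (n == m.+1) = false by lia.
  have -> : (uphalf n == uphalf m) = (n == m) by lia.
  by rewrite mulr0 addr0.
- rewrite rmorph1 mulr1.
  have -> : (n == m) = false by lia.
  have -> : (uphalf n == uphalf m) = (n == m.-1) by lia.
  by rewrite add0r.
- rewrite rmorphN /= i_conj opprK mul1r.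
  have -> : (n == m) = false by lia.
  have -> : (uphalf n == uphalf m) = (n == m.+1) by lia.
  by rewrite add0r.
- rewrite rmorph1 !mul1r.
  have -> : (n == m.-1) = false by lia.
  have -> : (uphalf n == uphalf m) = (n == m) by lia.
  by rewrite mulr0 addr0.
Qed.

End Correlations.

Lemma ordS_invariant_const (n : nat) (T : Type) (f : 'I_n.+1 -> T) :
  (forall i, f (ordS i) = f i) -> forall i j, f i = f j.
Proof.
move=> fS; suff h m (i : 'I_n.+1) : (i < m)%N -> f i = f ord0.
  by move=> i j; rewrite (h n.+1 i)// (h n.+1 j).
elim: m i => // m IH i; rewrite ltnS => im.
have [i0|i0] := posnP i; first by congr f; exact/val_inj.
rewrite -(ord_predK i) fS; apply: IH => /=.
have iL := ltn_ord i; have -> : (i + n.+1).-1 = (i.-1 + n.+1)%N by lia.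
by rewrite modnDr modn_small; lia.
Qed.

(** * Thermodynamic limit *)

Section Link.
Variables (R : realType) (L' : nat).
Hypothesis L_gt1 : (1 < L'.+1)%N.
Local Notation L := L'.+1.
Local Notation C := R[i].
Local Notation ph := (complex_phases R).
Local Notation ba := (pauli_algebra C L_gt1).
Variables gamma beta : nat -> R.
Local Notation st := (states ph ba (zero_state C L') (angle gamma beta)).
Local Notation psi := (@psi R L gamma beta).

Lemma flip_neq (u v : config L) j :
  (v == flip j u) = (u j != v j) && [forall i, (i != j) ==> (u i == v i)].
Proof.
apply/eqP/andP => [->|[uv /forallP h]].
  split; first by rewrite ffunE eqxx; case: (I2_cases (u j)) => ->.
  by apply/forallP => i; apply/implyP => ij; rewrite ffunE (negPf ij).
apply/ffunP => i; rewrite ffunE; case: eqP => [->|/eqP ij].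
  by move: uv; case: (I2_cases (u j)) => ->; case: (I2_cases (v j)) => ->.
by have /implyP/(_ ij)/eqP := h i.
Qed.

Lemma prod_eqE (u v : config L) j :
  \prod_(i < L | i != j) (u i == v i)%:R =
  [forall i, (i != j) ==> (u i == v i)]%:R :> C.
Proof.
case: (boolP [forall i, (i != j) ==> (u i == v i)]) => [/forallP h|].
  by rewrite big1// => i ij; have /implyP/(_ ij) -> := h i.
rewrite negb_forall => /existsP[i0]; rewrite negb_imply => /andP[ij uv].
by rewrite (bigD1 i0)//= (negPf uv) mul0r.
Qed.

Lemma X_E (j : 'I_L) : X_ R j = Xm C j.
Proof.
apply/matrixP => s t; rewrite !mxE /= prod_eqE flip_neq mxE.
by case: (_ != _); rewrite /= ?mul1r ?mul0r.
Qed.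

Lemma Z_E (j : 'I_L) : Z_ R j = Zm C j.
Proof.
apply/matrixP => s t; rewrite !mxE /= prod_eqE mxE /zsign.
set u : config L := enum_val s; set v : config L := enum_val t.
have -> : (v == u) = (u j == v j) && [forall i, (i != j) ==> (u i == v i)].
  apply/eqP/andP => [->|[/eqP uv /forallP h]].
    by split=> //; apply/forallP => i; apply/implyP.
  apply/ffunP => i; have [->//|ij] := eqVneq i j.
  by have /implyP/(_ ij)/eqP := h i.
by case: (u j == v j); rewrite /= ?mul0r// mulr1n mulr_natr.
Qed.

Lemma H1_layer t : - 'i%C * t%:C *: @H1 R L = ('i%C * t%:C) *: layer ba true.
Proof.
rewrite /H1 scalerN mulNr scaleNr opprK; congr (_ *: _).
by apply: eq_bigr => j _; rewrite !Z_E -pauli_bond_ZZE.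
Qed.

Lemma H2_layer t : - 'i%C * t%:C *: @H2 R L = ('i%C * t%:C) *: layer ba false.
Proof.
rewrite /H2 scalerN mulNr scaleNr opprK; congr (_ *: _).
by apply: eq_bigr => j _; rewrite X_E -pauli_bond_XE.
Qed.

Lemma psiE q : psi q = st q.*2.
Proof.
elim: q => [|q IH] //; rewrite doubleS /= IH odd_double /=.
rewrite /evol /angle /= odd_double /= uphalf_double doubleK.
by rewrite H1_layer H2_layer.
Qed.

Lemma expvalE q (A : 'M[C]_#|config L|) : expval (psi q) A = ev (st q.*2) A.
Proof. by rewrite psiE. Qed.

Lemma ev_XX_rotate q j k :
  ev (st q) (Xm C (ordS j) *m Xm C (ordS k)) = ev (st q) (Xm C j *m Xm C k).
Proof.
by apply: ev_rotate; rewrite mulmxA Tm_Xm -!mulmxA Tm_Xm.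
Qed.

Lemma ev_X_rotate q j : ev (st q) (Xm C (ordS j)) = ev (st q) (Xm C j).
Proof. by apply: ev_rotate; rewrite Tm_Xm. Qed.

Lemma shift_ordS l (j : 'I_L) : shift_site l (ordS j) = ordS (shift_site l j).
Proof. by rewrite /shift_site -iterSr. Qed.

Lemma connectedXX_ordS p l (j : 'I_L) :
  connectedXX gamma beta p l (ordS j) = connectedXX gamma beta p l j.
Proof.
rewrite /connectedXX !expvalE shift_ordS !X_E ev_XX_rotate.
by rewrite ev_X_rotate.
Qed.

Lemma connectedXX_const p l (j j' : 'I_L) :
  connectedXX gamma beta p l j = connectedXX gamma beta p l j'.
Proof.
by apply: (ordS_invariant_const (f := connectedXX gamma beta p l)) => i;
  exact: connectedXX_ordS.
Qed.

Lemma ev_X_shift s l j : ev (st s) (Xm C (shift_site l j)) = ev (st s) (Xm C j).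
Proof.
elim: l => [|l IH]; first exact: erefl.
by rewrite -[LHS]/(ev (st s) (Xm C (ordS (shift_site l j)))) ev_X_rotate IH.
Qed.

Lemma shift_site_inord m l : (m + l < L)%N ->
  shift_site l (inord m : 'I_L) = inord (m + l).
Proof.
elim: l => [|l IH] ml; first by rewrite addn0.
rewrite /shift_site /= -/(shift_site l _) IH; last by lia.
apply/val_inj; rewrite /= !inordK; [|lia..].
by rewrite modn_small; lia.
Qed.

Let c := maj ph ba.

Lemma two_point s n m : bulk L s n -> bulk L s m ->
  ev (st s) (c n *m c m) = corr gamma beta s n m.
Proof.
apply: ev2_states => //.
- exact: zero_norm.
- exact: zero_stab.
- by move=> i j /andP[i0 _] /andP[j0 _]; exact: corr0.
move=> r i j /andP[i0 _] /andP[j0 _]; rewrite corrS; [|lia..].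
rewrite /rcos /rsin /csgn phcosE phsinE.
by rewrite -/(ccos _ _ _) -/(csin _ _ _).
Qed.

(** Distinct c_n and c_m are self-adjoint and anticommute, so their product is anti-self-adjoint. *)
Lemma corr_conj s n m : bulk L s n -> bulk L s m -> n != m ->
  Num.conj (corr gamma beta s n m) = - corr gamma beta s n m.
Proof.
move=> bn bm nm; have [nM mM] : (n < L.*2)%N /\ (m < L.*2)%N.
  by move: bn bm; rewrite /bulk; lia.
have M2 : (2 < L.*2)%N by lia.
rewrite -two_point// -ev_adj cadjM !maj_adj//.
have := maj_acomm ph ba M2 nM mM; rewrite (negPf nm) mulr0 scale0r.
move=> /eqP; rewrite addr_eq0 => /eqP; rewrite -/c => ->.
by rewrite evN opprK.
Qed.

(** Site p + 1 is the first whose two Majorana operators are beyond the left light cone of 2p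
    half-layers; the bound on L keeps site p + 1 + l clear of the right one. *)
Lemma connectedXX_corr p l : (p.*2 + l + 2 < L)%N ->
  let s := p.*2 in let a := p.+1.*2 in let b := (p.+1 + l).*2 in
  connectedXX gamma beta p l (inord p.+1 : 'I_L) =
    corr gamma beta s a b * corr gamma beta s a.+1 b.+1
    - corr gamma beta s a b.+1 * corr gamma beta s a.+1 b.
Proof.
move=> pl s a b; rewrite /connectedXX !expvalE.
have M2 : (2 < L.*2)%N by lia.
(* Translation invariance turns the square into a product of the means at the two sites, the form
   that [wick_connected] subtracts. *)
rewrite expr2 !X_E -{2}(ev_X_shift _ l) shift_site_inord; last by lia.
have PE m : (m < L)%N -> Xm C (inord m) = 'i%C *: (c m.*2 *m c m.*2.+1).
  move=> mL; rewrite -(bondE ph ba M2); last by lia.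
  by rewrite /= /pauli_bond odd_double doubleK.
rewrite !PE; [|lia..].
have ba' n : (s < n)%N -> (n <= b.+1)%N -> bulk L s n.
  by rewrite /bulk /s /b; lia.
have b1 : bulk L s a by apply: ba'; rewrite /s /a /b; lia.
have b2 : bulk L s a.+1 by apply: ba'; rewrite /s /a /b; lia.
have b3 : bulk L s b by apply: ba'; rewrite /s /a /b; lia.
have b4 : bulk L s b.+1 by apply: ba'; rewrite /s /a /b; lia.
rewrite -(two_point b1 b3) -(two_point b2 b4) -(two_point b1 b4) -(two_point b2 b3).
apply: wick_connected; first exact: i_sqr.
exact: (wick_states ph L_gt1 (zero_norm C L') (@zero_stab C L' L_gt1)
  (angle gamma beta) b1 b2 b3 b4).
Qed.

End Link.

(** Put A = I (Z + W) / 2 and B = I (W - Z) / 2. X is imaginary while A and B are real, so the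
    squared moduli are A^2 - X^2 and B^2, and A^2 - B^2 = - Z W. *)
Lemma current_identity (K : numClosedFieldType) (I X Z W : K) :
  I * I = -1 -> Num.conj I = - I ->
  Num.conj X = - X -> Num.conj Z = - Z -> Num.conj W = - W ->
  X * - X - Z * W =
  `|2 * (- 4^-1 * X + 4^-1 * - X + I / 4 * Z + I / 4 * W)| ^+ 2 -
  `|2 * (4^-1 * X + 4^-1 * - X + - I / 4 * Z + I / 4 * W)| ^+ 2.
Proof.
move=> I2 Ic Xc Zc Wc.
have -> : 2 * (- 4^-1 * X + 4^-1 * - X + I / 4 * Z + I / 4 * W) =
  - X + 2^-1 * (I * (Z + W)) by field.
have -> : 2 * (4^-1 * X + 4^-1 * - X + - I / 4 * Z + I / 4 * W) =
  2^-1 * (I * (W - Z)) by field.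
have half : Num.conj (2^-1 : K) = 2^-1 by rewrite fmorphV /= conjC_nat.
rewrite !normCK.
have -> : Num.conj (- X + 2^-1 * (I * (Z + W))) = X + 2^-1 * (I * (Z + W)).
  rewrite rmorphD rmorphN rmorphM rmorphM rmorphD /= half Ic Xc Zc Wc.
  by rewrite opprK -opprD mulrNN.
have -> : Num.conj (2^-1 * (I * (W - Z))) = 2^-1 * (I * (W - Z)).
  by rewrite rmorphM rmorphM rmorphB /= half Ic Zc Wc -opprB opprK addrC; ring.
transitivity (- (X * X) + I * I * (Z * W)); first by rewrite I2; ring.
by field.
Qed.

Section Limit.
Variable R : realType.
Local Notation C := R[i].
Local Notation "''I'" := ('i%C : C).
Variables gamma beta : nat -> R.
Local Notation chi := (chi gamma beta).

Definition chi_ s (e : bool) k : C := if e then (chi s k).2 else (chi s k).1.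

(** The phases e^{ikm} of the two modes cancel: away from the cut the correlations are translation
    invariant. *)
Lemma corr_shift s m l (e e' : bool) :
  corr gamma beta s (e + m.*2) (e' + (m + l).*2) =
  mean (fun k => chi_ s e k * Num.conj (chi_ s e' k) * expi (- (k * l%:R))).
Proof.
apply: eq_mean => k _; rewrite /phi !half_bit_double !oddD !odd_double !addbF !oddb.
rewrite -/(chi_ s e k) -/(chi_ s e' k) rmorphM /= conj_expiE natrD mulrDr opprD expiD.
transitivity (expi (k * m%:R) * expi (- (k * m%:R)) *
  (chi_ s e k * Num.conj (chi_ s e' k) * expi (- (k * l%:R)))); first by ring.
by rewrite expiNK mul1r.
Qed.

Lemma ccont_chi_shift s l (e e' : bool) :
  ccont (fun k => chi_ s e k * Num.conj (chi_ s e' k) * expi (- (k * l%:R))).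
Proof.
have cc b : ccont (chi_ s b).
  by have [c1 c2] := ccont_chi gamma beta s; case: b.
apply: ccontM; first by apply: ccontM; [|apply: ccont_conj].
have := @ccont_expi R (- l%:R); rewrite (_ : (fun k => _) = (fun k => expi (- (k * l%:R))))//.
by apply/funext => k; rewrite mulrN.
Qed.

Local Notation D := (`]-pi, pi[ `\ 0 : set R).

Lemma in_D k : k \in D -> k \in `]-pi, pi[.
Proof. by rewrite inE => -[]. Qed.

Lemma limit_value p l (X Y Z W : C) : (0 < l)%N ->
  X = mean (fun k => chi_ p.*2 false k * Num.conj (chi_ p.*2 false k) * expi (- (k * l%:R))) ->
  Y = mean (fun k => chi_ p.*2 true k * Num.conj (chi_ p.*2 true k) * expi (- (k * l%:R))) ->
  Z = mean (fun k => chi_ p.*2 false k * Num.conj (chi_ p.*2 true k) * expi (- (k * l%:R))) ->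
  W = mean (fun k => chi_ p.*2 true k * Num.conj (chi_ p.*2 false k) * expi (- (k * l%:R))) ->
  Num.conj X = - X -> Num.conj Y = - Y -> Num.conj Z = - Z -> Num.conj W = - W ->
  X * Y - Z * W =
  `| (pi^-1)%:C * integral_pi (fun k =>
        ratio1 (g_ gamma beta p k) * expi (- (k * l%:R))) | ^+ 2
  - `| (pi^-1)%:C * integral_pi (fun k =>
        ratio2 (g_ gamma beta p k) * expi (- (k * l%:R))) | ^+ 2.
Proof.
move=> l0 XE YE ZE WE cX cY cZ cW.
have i2 := i_sqr R; have ic := i_conj R.
have cc := ccont_chi_shift p.*2 l.
(* The mode has constant squared norm 2, and e^{-ikl} has mean 0 because l >= 1. *)
have XY : X + Y = 0.
  rewrite XE YE -meanD//.
  transitivity (mean (fun k : R => 2 * expi (k * (0%:R - l%:R)))).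
    apply: eq_mean => k _; rewrite -mulrDl (chi_norm gamma beta).
    by rewrite sub0r mulrN.
  rewrite meanZ; last exact: ccont_expi.
  by rewrite mean_expi eq_sym (gtn_eqF l0) mulr0.
rewrite !pi_mean.
(* In normalised coordinates the ratio is u v^* / 4, whose expansion has one term for each of the
   four two-point functions. *)
have -> : mean (fun k => ratio1 (g_ gamma beta p k) * expi (- (k * l%:R))) =
   - 4^-1 * X + 4^-1 * Y + 'I / 4 * Z + 'I / 4 * W.
  rewrite XE YE ZE WE -mean_lin4//; apply: eq_mean => k /in_D kD.
  rewrite (ratio1_rep (rep_g gamma beta p kD)) /odd_u /odd_v /chi_.
  move: (chi p.*2 k).1 (chi p.*2 k).2 (expi _) => x y e.
  rewrite rmorphD rmorphM /= !conjCK ic.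
  transitivity ((- (x * Num.conj x) + - ('I * 'I) * (y * Num.conj y) +
     'I * (x * Num.conj y) + 'I * (y * Num.conj x)) / 4 * e); first by field.
  by rewrite i2; field.
have -> : mean (fun k => ratio2 (g_ gamma beta p k) * expi (- (k * l%:R))) =
   4^-1 * X + 4^-1 * Y + - 'I / 4 * Z + 'I / 4 * W.
  rewrite XE YE ZE WE -mean_lin4//; apply: eq_mean => k /in_D kD.
  rewrite (ratio2_rep (rep_g gamma beta p kD)) /odd_u /chi_.
  move: (chi p.*2 k).1 (chi p.*2 k).2 (expi _) => x y e.
  rewrite rmorphN rmorphB rmorphM /= !conjCK ic.
  transitivity ((x * Num.conj x + - ('I * 'I) * (y * Num.conj y) -
     'I * (x * Num.conj y) + 'I * (y * Num.conj x)) / 4 * e); first by field.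
  by rewrite i2; field.
have YX : Y = - X by apply/eqP; rewrite -addr_eq0 addrC XY.
by rewrite YX; exact: current_identity.
Qed.

End Limit.

Lemma connectedXX_limit (R : realType) (gamma beta : nat -> R) p l L' (j : 'I_L'.+1) :
  (0 < l)%N -> (p.*2 + l + 2 < L'.+1)%N ->
  connectedXX gamma beta p l j =
  `| (pi^-1)%:C * integral_pi (fun k =>
        ratio1 (g_ gamma beta p k) * expi (- (k * l%:R))) | ^+ 2
  - `| (pi^-1)%:C * integral_pi (fun k =>
        ratio2 (g_ gamma beta p k) * expi (- (k * l%:R))) | ^+ 2.
Proof.
move=> l0 pl; have L_gt1 : (1 < L'.+1)%N by lia.
rewrite (connectedXX_const L_gt1 _ _ _ _ _ (inord p.+1)) connectedXX_corr//.
have b n : (p.*2 < n)%N -> (n <= (p.+1 + l).*2.+1)%N -> bulk L'.+1 p.*2 n.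
  by rewrite /bulk; lia.
have cs := corr_shift gamma beta p.*2 p.+1 l.
have cc n m := @corr_conj R L' L_gt1 gamma beta p.*2 n m.
apply: (limit_value l0 (cs false false) (cs true true) (cs false true) (cs true false));
  by apply: cc; try apply: b; lia.
Qed.

Theorem mainTheorem4 (R : realType) (p : nat) (gamma beta : nat -> R) (l : nat)
    (p_ge1 : (1 <= p)%N) (l_ge1 : (1 <= l)%N) :
  (forall (n : nat) (j j' : 'I_(n.+1).*2),
      connectedXX gamma beta p l j = connectedXX gamma beta p l j') /\
  (forall site : forall n : nat, 'I_(n.+1).*2,
      (connectedXX gamma beta p l (site n) : R[i]^o) @[n --> \oo] -->
      (`| (pi^-1)%:C * integral_pi (fun k =>
            ratio1 (g_ gamma beta p k) * expi (- (k * l%:R))) | ^+ 2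
       - `| (pi^-1)%:C * integral_pi (fun k =>
            ratio2 (g_ gamma beta p k) * expi (- (k * l%:R))) | ^+ 2 : R[i]^o)).
Proof.
split=> [n j j'|site].
  (* The length [(n.+1).*2] reduces to [n.*2.+2], so [L'] is [n.*2.+1]. *)
  exact: (@connectedXX_const R n.*2.+1 isT).
apply: cvg_near_cst; exists (p.*2 + l + 2)%N => // n /= nl.
apply: (@connectedXX_limit R gamma beta p l n.*2.+1 (site n)) => //.
by move: nl; lia.
Qed.
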